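(* Consider the SPDHG iterates $z^k=(x^k,y^k)$ described in the context, and suppose in addition that the following metric subregularity assumption holds: there is a constant $\eta>0$ such that every $z^\star\in\mathcal{Z}^\star$ has a neighborhood $\mathcal{N}(z^\star)$ with $$\mathrm{dist}_S(z,\mathcal{Z}^\star)\le\eta\,\mathrm{dist}_S(0,Fz)\qquad\forall z\in\mathcal{N}(z^\star),$$ and $\mathcal{N}(z^\star)$ contains all the points $\hat z^{k}=(x^{k},\hat y^{k})$, $k\ge2$ (for every realization of the indices). Then for all $k\ge 1$ $$\mathbb{E}_k[\Delta^k]\le\Delta^{k-1}-V(z^k-z^{k-1}),$$ and $$\mathbb{E}\left[\frac{C_1}{2}\|x^k-x^k_\star\|^2_{\tau^{-1}}+\frac12\|y^{k+1}-y^{k+1}_\star\|^2_{\sigma^{-1}P^{-1}}\right]\le(1-\rho)^k\,2\Phi^0,$$ where $C_1=1-\gamma$, $\zeta=2+2\eta^2\|\boldsymbol H-\boldsymbol M\|^2$, $\underline p=\min_i p_i$, $\rho=\dfrac{C_1\underline p}{2\zeta}$, and $\Phi^0=\Delta^0-\dfrac{C_1}{4\zeta}\|y^0-y^0_\star\|^2_{\sigma^{-1}}$.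
   Context: **Problem.** $\mathcal{X},\mathcal{Y}_1,\dots,\mathcal{Y}_n$ are Euclidean spaces, $\mathcal{Y}=\prod_{i=1}^n\mathcal{Y}_i$, $\mathcal{Z}=\mathcal{X}\times\mathcal{Y}$, $z=(x,y)$. $A_i:\mathcal{X}\to\mathcal{Y}_i$ are linear, $Ax=(A_1x,\dots,A_nx)$, $A^\top$ is the adjoint of $A$. The problem is $\min_{x\in\mathcal{X}}\sum_{i=1}^n f_i(A_ix)+g(x)$, with $f(y)=\sum_i f_i(y_i)$. Standing assumptions: $f_i:\mathcal{Y}_i\to\mathbb{R}\cup\{+\infty\}$ and $g:\mathcal{X}\to\mathbb{R}\cup\{+\infty\}$ are proper, lower semicontinuous, convex; the problem has at least one minimizer; and $0\in\mathrm{ri}(\mathrm{dom} f-A\,\mathrm{dom} g)$. $h^\ast$ is the Fenchel conjugate of $h$, so $f^\ast(y)=\sum_i f_i^\ast(y_i)$. The KKT operator is $F(x,y)=\big(\partial g(x)+A^\top y,\ \partial f^\ast(y)-Ax\big)$ (set-valued on $\mathcal{Z}$), and $\mathcal{Z}^\star=F^{-1}(0)$ is the set of primal-dual solutions. **Norms.** For $\tau>0$, $\|x\|^2_{\tau^{-1}}=\tau^{-1}\|x\|^2$. For positive weights $w_1,\dots,w_n$, $\|y\|_w^2=\sum_i w_i\|y_i\|^2$; $\sigma^{-1}$ and $\sigma^{-1}P^{-1}$ denote the weights $\sigma_i^{-1}$ and $\sigma_i^{-1}p_i^{-1}$. $\|z\|_S^2=\|x\|^2_{\tau^{-1}}+\|y\|^2_{\sigma^{-1}}$,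 and $\mathrm{dist}_S(z,\mathcal{C})=\inf_{w\in\mathcal{C}}\|z-w\|_S$. $P^{\pm1}$ acts on $\mathcal{Y}$ by $(P^{\pm1}y)_i=p_i^{\pm1}y_i$. **Algorithm (SPDHG).** Probabilities $p_i>0$, $\sum_i p_i=1$; step sizes $\tau>0$, $\sigma_i>0$ satisfying $p_i^{-1}\tau\sigma_i\|A_i\|^2\le\gamma^2<1$ for all $i$, for some $\gamma\in[0,1)$. $\mathrm{prox}_{t,h}(x)=\arg\min_u h(u)+\frac{1}{2t}\|u-x\|^2$. Start from deterministic $x^0\in\mathcal{X}$, $y^0=y^1=\bar y^1\in\mathcal{Y}$. For $k=1,2,\dots$: $x^k=\mathrm{prox}_{\tau,g}(x^{k-1}-\tau A^\top\bar y^k)$; draw $i_k\in\{1,\dots,n\}$ independently of the past with $\Pr(i_k=i)=p_i$; $y^{k+1}_{i_k}=\mathrm{prox}_{\sigma_{i_k},f^\ast_{i_k}}(y^k_{i_k}+\sigma_{i_k}A_{i_k}x^k)$ and $y^{k+1}_i=y^k_i$ for $i\ne i_k$; $\bar y^{k+1}=y^{k+1}+P^{-1}(y^{k+1}-y^k)$. The full dual update is $\hat y^{k+1}_i=\mathrm{prox}_{\sigma_i,f_i^\ast}(y_i^k+\sigma_iA_ix^k)$ for all $i$. $\mathcal{F}_k$ is the $\sigma$-algebra generated by $i_1,\dots,i_{k-1}$ and $\mathbb{E}_k=\mathbb{E}[\cdot\mid\mathcal{F}_k]$. **Functions.** For $z=(x,y)\in\mathcal{Z}$ and $k\ge1$,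 $$V(z)=\tfrac12\|x\|^2_{\tau^{-1}}+\tfrac12\|y\|^2_{\sigma^{-1}P^{-1}}+\langle Ax,P^{-1}y\rangle,$$ $$V_k(x,y)=\tfrac12\|x\|^2_{\tau^{-1}}-\langle Ax,P^{-1}(y^k-y^{k-1})\rangle+\tfrac12\|y^k-y^{k-1}\|^2_{\sigma^{-1}P^{-1}}+\tfrac12\|y\|^2_{\sigma^{-1}P^{-1}}.$$ For $k\ge1$, $(x_\star^{k-1},y_\star^k)=\arg\min_{(x,y)\in\mathcal{Z}^\star}V_k(x^{k-1}-x,y^k-y)$, and $y^0_\star:=y^1_\star$ (recall $y^0=y^1$). For $k\ge0$, $\Delta^k=V_{k+1}(x^k-x^k_\star,y^{k+1}-y^{k+1}_\star)$. **Duplicated-space operators.** $\boldsymbol{\mathcal{Z}}=\mathcal{X}^n\times\mathcal{Y}^n$, with elements $(\boldsymbol x,\boldsymbol y)$, $\boldsymbol x(i)\in\mathcal{X}$, $\boldsymbol y(i)\in\mathcal{Y}$. Let $E(i):\mathcal{Y}\to\mathcal{Y}$ keep the $i$-th block and set the other blocks to zero. $\boldsymbol M(\boldsymbol x,\boldsymbol y)$ has primal copies $A^\top\boldsymbol y(i)$ and dual copies $-A\boldsymbol x(i)$; $\boldsymbol H(\boldsymbol x,\boldsymbol y)$ has primal copies $\tau^{-1}\boldsymbol x(i)+(1+p_i^{-1})A^\top E(i)\boldsymbol y(i)$ and dual copies $\mathrm{diag}(\sigma)^{-1}\boldsymbol y(i)$ (block $j$ multiplied by $\sigma_j^{-1}$),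 $i=1,\dots,n$. $\|\boldsymbol H-\boldsymbol M\|$ is the operator norm of $\boldsymbol H-\boldsymbol M$ on $\boldsymbol{\mathcal{Z}}$ with respect to the norm $\|(\boldsymbol x,\boldsymbol y)\|^2=\sum_{i=1}^n p_i\big(\|\boldsymbol x(i)\|^2_{\tau^{-1}}+\|\boldsymbol y(i)\|^2_{\sigma^{-1}}\big)$. *)

(* Defs.v *)
From HB Require Import structures.
From mathcomp Require Import all_boot all_order all_algebra.
From mathcomp Require Import all_classical all_reals all_analysis.

Set Implicit Arguments.
Unset Strict Implicit.
Unset Printing Implicit Defensive.

Import Order.TTheory GRing.Theory Num.Theory.
Import numFieldNormedType.Exports.

Local Open Scope classical_set_scope.
Local Open Scope ring_scope.

Definition is_argmin (T : Type) (disp : Order.disp_t) (O : porderType disp)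
    (C : set T) (h : T -> O) (u : T) : Prop :=
  C u /\ forall v, C v -> (h u <= h v)%O.

(* Operator norm of T for arbitrary norms on its source and target.  The real
   [sup] is the genuine supremum here: it is only applied to linear maps between
   finite-dimensional spaces, for which the set is nonempty and bounded. *)
Definition opnorm (R : realType) (U W : Type) (normU : U -> R) (normW : W -> R)
    (T : U -> W) : R :=
  sup [set normW (T u) | u in [set u | normU u <= 1]].

(* Euclidean spaces are the spaces ['cV[R]_l] with the dot product below.  The
   library norm [`|u|] on matrices is the maximum norm, hence [enorm]; the
   topology of ['cV[R]_l] (used by [nbhs] and [lower_semicontinuous]) is the
   usual one. *)
Section Convex.
Context {R : realType} {l : nat}.
Implicit Types (u v w : 'cV[R]_l) (h : 'cV[R]_l -> \bar R) (C : set 'cV[R]_l).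

Definition dotv u v : R := \sum_(j < l) u j 0 * v j 0.
Definition sqnorm u : R := dotv u u.
Definition enorm u : R := Num.sqrt (sqnorm u).

Definition dom h : set 'cV[R]_l := [set u | (h u < +oo)%E].

Definition proper h : Prop :=
  (exists u, dom h u) /\ forall u, (-oo < h u)%E.

Definition convex_ereal h : Prop :=
  forall u v (t : R), 0 < t < 1 ->
    (h (t *: u + (1 - t) *: v)%R <= t%:E * h u + (1 - t)%R%:E * h v)%E.

Definition proper_lsc_convex h : Prop :=
  [/\ proper h, lower_semicontinuous h & convex_ereal h].

Definition conjugate h : 'cV[R]_l -> \bar R :=
  fun v => ereal_sup [set ((dotv u v)%:E - h u)%E | u in setT].

(* For a proper [h] this set is empty outside [dom h]. *)
Definition subdiff h u : set 'cV[R]_l :=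
  [set v | forall w, (h u + (dotv v (w - u)%R)%:E <= h w)%E].

Definition is_prox (t : R) h v u : Prop :=
  is_argmin setT (fun w => h w + ((2 * t)^-1 * sqnorm (w - v))%R%:E)%E u.

Definition affine_hull C : set 'cV[R]_l :=
  [set v | exists k (a : 'I_k -> R) (c : 'I_k -> 'cV[R]_l),
    [/\ forall j, C (c j), \sum_j a j = 1 & v = \sum_j a j *: c j]].

Definition relint C : set 'cV[R]_l :=
  [set v | affine_hull C v /\
           exists2 U, nbhs v U & U `&` affine_hull C `<=` C].

End Convex.

(* The product of the spaces ['cV[R]_(dim i)] is the space of block columns
   ['cV[R]_(\sum_i dim i)]; the i-th component of [y] is [submxcol y i]. *)
Section Problem.
Context {R : realType} {n m : nat} {dim : 'I_n -> nat}.
Notation X := 'cV[R]_m.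
Notation Y := 'cV[R]_(\sum_i dim i).
Notation Z := (X * Y)%type.
Implicit Types (x : X) (y : Y) (z : Z) (p sigma a : 'I_n -> R) (tau : R).
Implicit Types (A : forall i, 'M[R]_(dim i, m)).
Implicit Types (f : forall i, 'cV[R]_(dim i) -> \bar R) (g : X -> \bar R).

Definition scale_blocks a y : Y := \mxcol_i (a i *: submxcol y i).

Definition keep_block (i : 'I_n) y : Y :=
  \mxcol_j (if j == i then submxcol y j else 0).

Definition stack A : 'M[R]_(\sum_i dim i, m) := \mxcol_i A i.

Lemma dotv_blocks (y y' : Y) :
  dotv y y' = \sum_i dotv (submxcol y i) (submxcol y' i).
Proof.
rewrite /dotv sig_big_dep/= (reindex _ tagnat.sig_bij_on)/=.
by apply: eq_bigr => j _; rewrite !mxE -tagnat.rankE tagnat.sigK.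
Qed.

Lemma adjoint_stack A x y : dotv (stack A *m x) y = dotv x ((stack A)^T *m y).
Proof.
have dotvE l (u v : 'cV[R]_l) : dotv u v = (u^T *m v) 0 0.
  by rewrite mxE; apply: eq_bigr => j _; rewrite mxE.
by rewrite !dotvE trmx_mul mulmxA.
Qed.

Definition fsum f y : \bar R := (\sum_i f i (submxcol y i))%E.

Definition objective A f g x : \bar R := (fsum f (stack A *m x)%R + g x)%E.

Definition standing_assumptions A f g : Prop :=
  [/\ forall i, proper_lsc_convex (f i),
      proper_lsc_convex g,
      exists x, is_argmin setT (objective A f g) x &
      relint [set y | exists y' x',
                [/\ dom (fsum f) y', dom g x' & y = y' - stack A *m x']] 0].

Definition KKT A f g z : set Z :=
  [set w | exists u v,
    [/\ subdiff g z.1 u, subdiff (conjugate (fsum f)) z.2 v &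
        w = (u + (stack A)^T *m z.2, v - stack A *m z.1)]].

Definition Zstar A f g : set Z := [set z | KKT A f g z 0].

Definition wsqnorm (w : 'I_n -> R) y : R := \sum_i w i * sqnorm (submxcol y i).

Definition sqnormX tau x : R := tau^-1 * sqnorm x.
Definition sqnormY sigma y : R := wsqnorm (fun i => (sigma i)^-1) y.
Definition sqnormYP sigma p y : R :=
  wsqnorm (fun i => (sigma i)^-1 * (p i)^-1) y.

Definition normS tau sigma z : R :=
  Num.sqrt (sqnormX tau z.1 + sqnormY sigma z.2).

(* Extended-real valued, so that the distance to an empty set is [+oo]; this
   occurs for [KKT A f g z] when a subdifferential is empty. *)
Definition distS tau sigma z (C : set Z) : \bar R :=
  ereal_inf [set (normS tau sigma (z - w))%:E | w in C].

Definition step_sizes A p sigma tau (gamma : R) : Prop :=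
  [/\ 0 < tau, forall i, 0 < sigma i, 0 <= gamma < 1 &
      forall i, (p i)^-1 * tau * sigma i * opnorm enorm enorm (mulmx (A i)) ^+ 2
                <= gamma ^+ 2].

(* One realization of the algorithm: the draws are [ix 1], [ix 2], ...; [ix 0]
   is not used. *)

Definition spdhg_run A f g p sigma tau (x0 : X) (y0 : Y) (ix : nat -> 'I_n)
    (x : nat -> X) (y ybar : nat -> Y) : Prop :=
  [/\ x 0%N = x0, y 0%N = y0, y 1%N = y0, ybar 1%N = y0 &
      forall k, (1 <= k)%N ->
      [/\ is_prox tau g (x k.-1 - tau *: ((stack A)^T *m ybar k)) (x k),
          is_prox (sigma (ix k)) (conjugate (f (ix k)))
            (submxcol (y k) (ix k) + sigma (ix k) *: (A (ix k) *m x k))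
            (submxcol (y k.+1) (ix k)),
          forall j, j != ix k -> submxcol (y k.+1) j = submxcol (y k) j &
          ybar k.+1 = y k.+1
            + scale_blocks (fun j => (p j)^-1) (y k.+1 - y k)]].

Definition full_dual_update A f sigma (x : nat -> X) (y yhat : nat -> Y) : Prop :=
  forall k, (1 <= k)%N -> forall j,
    is_prox (sigma j) (conjugate (f j))
      (submxcol (y k) j + sigma j *: (A j *m x k)) (submxcol (yhat k.+1) j).

Definition V A p sigma tau z : R :=
  2^-1 * sqnormX tau z.1 + 2^-1 * sqnormYP sigma p z.2
  + dotv (stack A *m z.1) (scale_blocks (fun j => (p j)^-1) z.2).

(* [y] is the sequence of dual iterates. *)
Definition Vk A p sigma tau (y : nat -> Y) (k : nat) (z : Z) : R :=
  let dy := y k - y k.-1 in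
  2^-1 * sqnormX tau z.1
  - dotv (stack A *m z.1) (scale_blocks (fun j => (p j)^-1) dy)
  + 2^-1 * sqnormYP sigma p dy + 2^-1 * sqnormYP sigma p z.2.

(* [xs k] and [ys k] are the components with index k (k >= 0): the k-th
   minimizer is [(xs k.-1, ys k)].  It is unique: the function is strongly convex and [Zstar] is
   convex. *)
Definition is_star A f g p sigma tau (x : nat -> X) (y : nat -> Y)
    (xs : nat -> X) (ys : nat -> Y) : Prop :=
  (forall k, (1 <= k)%N ->
     is_argmin (Zstar A f g)
       (fun z => Vk A p sigma tau y k (x k.-1 - z.1, y k - z.2))
       (xs k.-1, ys k))
  /\ ys 0%N = ys 1%N.

Definition Delta A p sigma tau (x : nat -> X) (y : nat -> Y)
    (xs : nat -> X) (ys : nat -> Y) (k : nat) : R :=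
  Vk A p sigma tau y k.+1 (x k - xs k, y k.+1 - ys k.+1).

Definition ZZ : Type := (('I_n -> X) * ('I_n -> Y))%type.

Definition Mop A (q : ZZ) : ZZ :=
  (fun i => (stack A)^T *m q.2 i, fun i => - (stack A *m q.1 i)).

Definition Hop A p sigma tau (q : ZZ) : ZZ :=
  (fun i => tau^-1 *: q.1 i
            + (1 + (p i)^-1) *: ((stack A)^T *m keep_block i (q.2 i)),
   fun i => scale_blocks (fun j => (sigma j)^-1) (q.2 i)).

Definition HMop A p sigma tau (q : ZZ) : ZZ :=
  (fun i => (Hop A p sigma tau q).1 i - (Mop A q).1 i,
   fun i => (Hop A p sigma tau q).2 i - (Mop A q).2 i).

Definition normZZ p sigma tau (q : ZZ) : R :=
  Num.sqrt (\sum_i p i * (sqnormX tau (q.1 i) + sqnormY sigma (q.2 i))).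

Definition normHM A p sigma tau : R :=
  opnorm (normZZ p sigma tau) (normZZ p sigma tau) (HMop A p sigma tau).

Definition metric_subregularity A f g sigma tau (eta : R) (Omega : Type)
    (x : nat -> Omega -> X) (yhat : nat -> Omega -> Y) : Prop :=
  forall zs, Zstar A f g zs ->
  exists N : set Z,
    [/\ nbhs zs N,
        forall z, N z ->
          (distS tau sigma z (Zstar A f g)
             <= eta%:E * distS tau sigma 0%R (KKT A f g z))%E &
        forall k w, (2 <= k)%N -> N (x k w, yhat k w)].

End Problem.

Section Probability.
Context {R : realType} {disp : measure_display} {Omega : measurableType disp}.
Variable P : probability Omega R.

(* The sigma-algebra generated by the indices 1, ..., k-1. *)
Definition filtration {n : nat} (ix : nat -> Omega -> 'I_n) (k : nat) :
    set_system Omega :=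
  <<s [set B | exists j (a : 'I_n),
         (1 <= j < k)%N /\ B = [set w | ix j w = a]] >>.

Definition independent_draws {n : nat} (p : 'I_n -> R)
    (ix : nat -> Omega -> 'I_n) : Prop :=
  forall k, (1 <= k)%N -> forall a : 'I_n,
    [/\ measurable [set w | ix k w = a],
        P [set w | ix k w = a] = (p a)%:E &
        forall B, filtration ix k B ->
          P (B `&` [set w | ix k w = a]) = (P B * P [set w | ix k w = a])%E].

(* [W] is a version of the conditional expectation of [U] given the
   sub-sigma-algebra [F]. *)
Definition is_cond_exp (F : set_system Omega) (U W : Omega -> R) : Prop :=
  [/\ P.-integrable setT (EFin \o U),
      P.-integrable setT (EFin \o W),
      forall B : set R, measurable B -> F (W @^-1` B) &
      forall B, F B ->
        (\int[P]_(w in B) (W w)%:E = \int[P]_(w in B) (U w)%:E)%E].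

End Probability.

(* Main.v *)
Require Import Defs.
From HB Require Import structures.
From mathcomp Require Import all_boot all_order all_algebra.
From mathcomp Require Import all_classical all_reals all_analysis.
From mathcomp Require Import ring lra.

Set Implicit Arguments.
Unset Strict Implicit.
Unset Printing Implicit Defensive.

Import Order.TTheory GRing.Theory Num.Theory.
Import numFieldNormedType.Exports.

Local Open Scope classical_set_scope.
Local Open Scope ring_scope.

Local Notation proper := Defs.proper.

(** Let D_k be the squared norm of z^(k+1) - z^k.  Monotonicity of the
    subdifferentials at the two proximal steps and at a solution gives
    E_k[Delta^k] <= Delta^(k-1) - V(z^k - z^(k-1)), and V(z^k - z^(k-1)) is at
    least C1/2 D_(k-1), since a single dual block is updated.  The KKT residuals
    of the points (x^(k+1), yhat^(k+1)) are the components of (H - M) q for the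
    vector q of increments, so metric subregularity bounds their mean squared
    distance to the solution set by eta^2 ||H - M||^2 times the expected D_k.  By
    the triangle inequality the distance of (x^k, yhat^(k+1)) to any solution is
    then controlled by D_k too, and it dominates pmin times the mean of Delta^k:
    pmin E[Delta^k] <= zeta E[D_k].  Together, E[Delta^(k+1)] <= (1 - rho)
    E[Delta^k] for k >= 1.

    Delta^k is a minimum value, hence a function of the first k draws, and every
    history of draws has positive probability; conditional expectations are
    therefore finite averages over realizations that share a history. *)

(** * Dot product and operator norm *)

Section DotProduct.
Context {R : realType} {l : nat}.
Implicit Types (u v w : 'cV[R]_l) (a : R).

Lemma dotvC u v : dotv u v = dotv v u.
Proof. by apply: eq_bigr => j _; rewrite mulrC. Qed.

Lemma dotvDl u v w : dotv (u + v) w = dotv u w + dotv v w.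
Proof. by rewrite -big_split; apply: eq_bigr => j _; rewrite mxE mulrDl. Qed.

Lemma dotvZl a u v : dotv (a *: u) v = a * dotv u v.
Proof. by rewrite [RHS]mulr_sumr; apply: eq_bigr => j _; rewrite mxE mulrA. Qed.

Lemma dotvNl u v : dotv (- u) v = - dotv u v.
Proof. by rewrite -scaleN1r dotvZl mulN1r. Qed.

Lemma dotvDr u v w : dotv u (v + w) = dotv u v + dotv u w.
Proof. by rewrite dotvC dotvDl !(dotvC u). Qed.

Lemma dotvZr a u v : dotv u (a *: v) = a * dotv u v.
Proof. by rewrite dotvC dotvZl dotvC. Qed.

Lemma dotvNr u v : dotv u (- v) = - dotv u v.
Proof. by rewrite dotvC dotvNl dotvC. Qed.

Definition dotv_lin := (dotvDl, dotvDr, dotvNl, dotvNr, dotvZl, dotvZr).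

Lemma sqnorm_ge0 u : 0 <= sqnorm u.
Proof. by apply: sumr_ge0 => j _; rewrite -expr2 sqr_ge0. Qed.

Lemma sqnorm_eq0 u : sqnorm u = 0 -> u = 0.
Proof.
move=> /eqP; rewrite psumr_eq0 => [/allP u0|j _]; last by rewrite -expr2 sqr_ge0.
apply/colP => j; have := u0 j (mem_index_enum j).
by rewrite mulf_eq0 orbb mxE => /eqP.
Qed.

Lemma sqnormD u v : sqnorm (u + v) = sqnorm u + 2 * dotv u v + sqnorm v.
Proof. by rewrite /sqnorm !dotv_lin (dotvC v u); ring. Qed.

Lemma sqnormN u : sqnorm (- u) = sqnorm u.
Proof. by rewrite /sqnorm dotvNl dotvNr opprK. Qed.

Lemma sqnormBC u v : sqnorm (u - v) = sqnorm (v - u).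
Proof. by rewrite -sqnormN opprB. Qed.

Lemma sqnormB u v : sqnorm (u - v) = sqnorm u - 2 * dotv u v + sqnorm v.
Proof. by rewrite sqnormD sqnormN dotvNr mulrN. Qed.

Lemma sqnormZ a u : sqnorm (a *: u) = a ^+ 2 * sqnorm u.
Proof. by rewrite /sqnorm dotvZl dotvZr mulrA -expr2. Qed.

Lemma sqnorm0 : sqnorm (0 : 'cV[R]_l) = 0.
Proof. by rewrite -(scale0r 0) sqnormZ expr0n mul0r. Qed.

Lemma sqnormD_le u v : sqnorm (u + v) <= 2 * sqnorm u + 2 * sqnorm v.
Proof. by have := sqnorm_ge0 (u - v); rewrite sqnormB sqnormD; lra. Qed.

Lemma dotv_sqr_le u v : dotv u v ^+ 2 <= sqnorm u * sqnorm v.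
Proof.
have [/sqnorm_eq0 ->|v0] := eqVneq (sqnorm v) 0.
  by rewrite dotvC -(scale0r 0) dotvZl mul0r expr0n sqnormZ expr0n mul0r mulr0.
have vp : 0 < sqnorm v by rewrite lt_def v0 sqnorm_ge0.
have := sqnorm_ge0 (sqnorm v *: u - dotv u v *: v).
rewrite sqnormB !sqnormZ dotvZl dotvZr => h.
rewrite -subr_ge0 -(pmulr_rge0 _ vp); congr (_ <= _): h; ring.
Qed.

Lemma enorm_ge0 u : 0 <= enorm u. Proof. exact: sqrtr_ge0. Qed.

Lemma sqr_enorm u : enorm u ^+ 2 = sqnorm u.
Proof. by rewrite sqr_sqrtr ?sqnorm_ge0. Qed.

Lemma enormZ a u : enorm (a *: u) = `|a| * enorm u.
Proof. by rewrite /enorm sqnormZ sqrtrM ?sqr_ge0// sqrtr_sqr. Qed.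

End DotProduct.

Lemma sqnorm_mulmx_le (R : realType) (k l : nat) (B : 'M[R]_(k, l)) :
  exists2 c, 0 <= c & forall u, sqnorm (B *m u) <= c * sqnorm u.
Proof.
exists (\sum_i sqnorm (row i B)^T) => [|u].
  by apply: sumr_ge0 => i _; exact: sqnorm_ge0.
rewrite mulr_suml; apply: ler_sum => i _.
have -> : (B *m u) i 0 = dotv (row i B)^T u.
  by rewrite mxE; apply: eq_bigr => j _; rewrite !mxE.
by rewrite -expr2 dotv_sqr_le.
Qed.

Section OperatorNorm.
Context {R : realType} {U W : Type}.
Variables (normU : U -> R) (normW : W -> R) (T : U -> W) (scale : R -> U -> U).
Variable c : R.
Hypotheses (c0 : 0 <= c) (U0 : forall u, 0 <= normU u).
Hypothesis bT : forall u, normW (T u) <= c * normU u.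
Hypothesis sU : forall a u, 0 <= a -> normU (scale a u) = a * normU u.
Hypothesis sW : forall a u, 0 <= a -> normW (T (scale a u)) = a * normW (T u).

(** Rescaling [u] to norm 1 gives a member of the set under the supremum. The bound [c] makes the
    real [sup] a true upper bound of that set and also settles the case of zero norm. *)
Lemma le_opnorm u : normW (T u) <= opnorm normU normW T * normU u.
Proof.
have [u0|u0] := eqVneq (normU u) 0.
  by apply: le_trans (bT u) _; rewrite u0 !mulr0.
have up : 0 < normU u by rewrite lt_def u0 U0.
rewrite -ler_pdivrMr// mulrC -sW ?invr_ge0//.
apply: ub_le_sup; last first.
  by exists (scale (normU u)^-1 u); rewrite //= sU ?invr_ge0// mulVf.
exists c => _ [v /= v1 <-]; apply: le_trans (bT v) _.
by rewrite ler_piMr.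
Qed.

End OperatorNorm.

(** * Proximal points and subgradients *)

Lemma ler_small_addP (R : realType) (a b c s0 : R) : 0 <= c -> 0 < s0 ->
  (forall s, 0 < s < s0 -> a <= b + c * s) -> a <= b.
Proof.
move=> c0 s00 h; apply/ler_addgt0Pr => e e0.
have c1 : 0 < c + 1 by lra.
have e1 : 0 < e / (c + 1) by rewrite divr_gt0.
(* Half of [s0] keeps [s] in the allowed range; [e / (c + 1)] makes [c * s] at most [e]. *)
pose s := Num.min (s0 / 2) (e / (c + 1)).
have s1 : 0 < s by rewrite lt_min e1 andbT; lra.
have s2 : s < s0 by rewrite gt_min; apply/orP; left; lra.
apply: le_trans (h s _) _; first by rewrite s1 s2.
rewrite lerD2l; apply: (@le_trans _ _ (c * (e / (c + 1)))).
  by rewrite ler_wpM2l// ge_min lexx orbT.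
by rewrite mulrA ler_pdivrMr//; nra.
Qed.

Section Convex.
Context {R : realType} {l : nat}.
Implicit Types (u v w : 'cV[R]_l) (h : 'cV[R]_l -> \bar R).

Lemma proper_domE h u : proper h -> dom h u -> exists a, h u = a%:E.
Proof.
by move=> [_ /(_ u)]; rewrite /dom /=; case: (h u) => [a| |]// _ _; exists a.
Qed.

Lemma subdiff_dom h u v : proper h -> subdiff h u v -> dom h u.
Proof.
move=> ph; have [[w wd] hN] := ph => /(_ w); have [b ->] := proper_domE ph wd.
by rewrite /dom/=; case: (h u) => [a| |]//=; rewrite ltry.
Qed.

(** Minimality is tested on the segment from [u] to [w]: by convexity and expansion of the square,
    the subgradient inequality holds up to an error linear in [s], which then tends to 0. The range
    of [s] may depend on [w], so that interior minimizers over a ball qualify as well as global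
    ones. *)
Lemma local_argmin_subdiff h (c : R) u v : proper h -> convex_ereal h ->
  0 <= c -> dom h u ->
  (forall w, exists2 s0, 0 < s0 & forall s, 0 < s < s0 ->
    (h u + (c * sqnorm (u - v)%R)%:E <=
     h (u + s *: (w - u))%R + (c * sqnorm (u + s *: (w - u) - v)%R)%:E)%E) ->
  subdiff h u ((2 * c) *: (v - u)).
Proof.
move=> ph ch c0 ud hmin w.
have [a ha] := proper_domE ph ud.
have [|] := ltP (h w) +oo%E; last by rewrite leye_eq => /eqP ->; rewrite leey.
move=> wd; have [b hb] := proper_domE ph wd.
rewrite ha hb -EFinD lee_fin dotvZl -lerBrDr.
have [s0 s00 {}hmin] := hmin w.
apply: (@ler_small_addP _ _ _ (c * sqnorm (w - u)) (Num.min s0 1)).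
- by rewrite mulr_ge0 ?sqnorm_ge0.
- by rewrite lt_min s00 ltr01.
move=> s; rewrite lt_min => /andP[s1 /andP[s2 s3]].
have := hmin s; rewrite s1 s2 => /(_ isT).
have := ch w u s; rewrite s1 s3 => /(_ isT).
have -> : s *: w + (1 - s) *: u = u + s *: (w - u).
  by rewrite scalerBr scalerBl scale1r addrCA addrA.
have := ph.2 (u + s *: (w - u)); rewrite ha hb.
case: (h _) => [d| |]// _; rewrite -?EFinM -!EFinD ?leye_eq// !lee_fin.
have -> : u + s *: (w - u) - v = (u - v) + s *: (w - u) by rewrite addrAC.
rewrite [sqnorm (_ + s *: _)]sqnormD sqnormZ dotvZr => h1 h2.
have -> : dotv (v - u) (w - u) = - dotv (u - v) (w - u).
  by rewrite -[v - u]opprB dotvNl.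
rewrite -(ler_pM2l s1).
move: (sqnorm (u - v)) (dotv (u - v) (w - u)) (sqnorm (w - u)) h1 h2 => q1 q2 q3.
nra.
Qed.

Lemma prox_subdiff h (t : R) v u : proper h -> convex_ereal h -> 0 < t ->
  is_prox t h v u -> dom h u /\ subdiff h u (t^-1 *: (v - u)).
Proof.
move=> ph ch t0 [_ hmin].
have ud : dom h u.
  have [w wd] := ph.1; have [b hb] := proper_domE ph wd.
  have := hmin w I; rewrite hb /dom/=.
  by case: (h u) => [a| |]//=; rewrite ltry.
split=> //; have -> : t^-1 = 2 * (2 * t)^-1 by field; rewrite lt0r_neq0.
apply: local_argmin_subdiff => //; first by rewrite invr_ge0; lra.
by move=> w; exists 1; rewrite ?ltr01// => s _; exact: hmin.
Qed.

Lemma subdiff_monotone h u1 u2 v1 v2 : proper h ->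
  subdiff h u1 v1 -> subdiff h u2 v2 -> 0 <= dotv (v1 - v2) (u1 - u2).
Proof.
move=> ph s1 s2.
have [a1 h1] := proper_domE ph (subdiff_dom ph s1).
have [a2 h2] := proper_domE ph (subdiff_dom ph s2).
have := s1 u2; have := s2 u1; rewrite h1 h2 -!EFinD !lee_fin.
by rewrite !dotv_lin; lra.
Qed.

(** Monotonicity of the two subgradients supplied by the proximal steps reads, up to the factor
    [t^-1], [- sqnorm (u1 - u2) >= 0]. Uniqueness is what makes the iterates functions of the
    draws. *)
Lemma prox_unique h (t : R) v u1 u2 : proper h -> convex_ereal h -> 0 < t ->
  is_prox t h v u1 -> is_prox t h v u2 -> u1 = u2.
Proof.
move=> ph ch t0 /(prox_subdiff ph ch t0)[_ s1] /(prox_subdiff ph ch t0)[_ s2].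
have := subdiff_monotone ph s1 s2; rewrite -scalerBr dotvZl.
rewrite pmulr_rge0 ?invr_gt0//.
have -> : v - u1 - (v - u2) = - (u1 - u2).
  by rewrite [- (v - u2)]opprB addrC addrA subrK opprB.
rewrite dotvNl oppr_ge0 => le0; apply/eqP; rewrite -subr_eq0; apply/eqP.
by apply: sqnorm_eq0; apply/le_anti; rewrite le0 sqnorm_ge0.
Qed.

Lemma conjugate_convex h : proper h -> convex_ereal (conjugate h).
Proof.
move=> ph u v t /andP[t0 t1]; apply: ge_ereal_sup => _ [w _ <-].
have [wd|] := ltP (h w) +oo%E; last first.
  by rewrite leye_eq => /eqP ->; rewrite leNye.
have [b hb] := proper_domE ph wd.
have le1 z : ((dotv w z - b)%:E <= conjugate h z)%E.
  by apply: ereal_sup_ubound; exists w => //; rewrite hb EFinB.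
have le2 (s : R) z : 0 < s -> ((s * (dotv w z - b))%:E <= s%:E * conjugate h z)%E.
  by move=> s0; rewrite EFinM lee_wpmul2l// lee_fin ltW.
have t1' : 0 < 1 - t by rewrite subr_gt0.
apply: le_trans (leeD (le2 _ u t0) (le2 _ v t1')).
rewrite hb -!EFinD lee_fin dotvDr !dotvZr.
by rewrite le_eqVlt; apply/orP; left; apply/eqP; ring.
Qed.

End Convex.

(** * Conjugates of proper lower semicontinuous convex functions *)

(** Without a minimizer, each point of [K] has a neighborhood on which [h] exceeds some value taken
    in [K]. Near-covering compactness, applied along the filter of sublevel sets, makes a single
    value [h w0] with [w0] in [K] lie strictly below [h] on all of [K], hence below itself. *)
Lemma lsc_compact_min (R : realType) (T : topologicalType) (K : set T)
    (h : T -> \bar R) : lower_semicontinuous h -> compact K -> K !=set0 ->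
  exists2 u, K u & forall v, K v -> (h u <= h v)%E.
Proof.
move=> lsch /compact_near_coveringP cK [u0 Ku0].
apply: contrapT => nomin.
have noK u : K u -> exists2 v, K v & (h v < h u)%E.
  move=> Ku; apply: contrapT => nov; apply: nomin; exists u => // v Kv.
  by rewrite leNgt; apply/negP => hv; apply: nov; exists v.
pose F := filter_from K (fun w0 => [set w | K w /\ (h w <= h w0)%E]).
have FF : ProperFilter F.
  apply: filter_from_proper; last by move=> i Ki; exists i; split.
  apply: filter_from_filter => [|i j Ki Kj]; first by exists u0.
  have [hij|/ltW hji] := leP (h i) (h j).
    by exists i => // w [Kw hw]; do !split=> //; apply: le_trans hij.
  by exists j => // w [Kw hw]; do !split=> //; apply: le_trans hji.
have : \forall w \near F, K `<=` (fun x => (h w < h x)%E).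
  apply: (cK _ F (fun w x => (h w < h x)%E)) => x Kx.
  have [v Kv hvx] := noK x Kx.
  have [a hva hax] : exists2 a : R, (h v <= a%:E)%E & (a%:E < h x)%E.
    case: (h v) (h x) hvx => [b| |] [c| |]//; rewrite ?lte_fin => hbc.
    - by exists b; rewrite ?lte_fin.
    - by exists b; rewrite ?ltry.
    - by exists (c - 1); rewrite ?lte_fin ?leNye//; lra.
    - by exists 0; rewrite ?leNye ?ltry.
  have [V Vx hV] := lsch x a hax.
  exists (V, [set w | K w /\ (h w <= h v)%E]).
    by split=> //; exists v.
  move=> [y w] /= [/hV Vy [_ hw]]; apply: le_lt_trans Vy.
  exact: le_trans hva.
move=> [w0 Kw0 /(_ w0)]; rewrite /= => /(_ (conj Kw0 (lexx _))) /(_ w0 Kw0).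
by rewrite ltxx.
Qed.

Section Conjugate.
Context {R : realType} {l : nat}.
Implicit Types (u v w : 'cV[R]_l) (h : 'cV[R]_l -> \bar R).

Lemma cV_norm_le u (a : R) : 0 <= a ->
  (`|u| <= a) <-> (forall i, `|u i 0| <= a).
Proof.
move=> a0; rewrite [`|u|]mx_normrE; split=> [/bigmax_leP[_ h] i|h].
  exact: (h (i, 0)).
by apply/bigmax_leP; split=> // -[i j] _ /=; rewrite ord1.
Qed.

(** In the maximum norm the ball is a box, a product of segments; compactness of the box of row
    vectors is carried over by the continuous transposition. *)
Lemma cV_ball_compact u : compact [set v | `|v - u| <= 1].
Proof.
pose B := [set v : 'rV[R]_l |
  forall i, `[u i 0 - 1, u i 0 + 1]%classic (v ord0 i)].
have cB : compact B.
  by apply: (@rV_compact R l (fun i => `[u i 0 - 1, u i 0 + 1]%classic)) => i;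
     exact: segment_compact.
have -> : [set v | `|v - u| <= 1] = [set x^T | x in B].
  apply/seteqP; split=> [v /= /(cV_norm_le _ ler01) h|_ [x xB <-]].
    exists v^T; rewrite ?trmxK// => i /=.
    by have := h i; rewrite !mxE in_itv /= ler_norml; lra.
  apply/(cV_norm_le _ ler01) => i; have := xB i.
  by rewrite !mxE /= in_itv /= ler_norml; lra.
apply: continuous_compact => //; apply: continuous_subspaceT => x A [Q Qx QA].
exists (fun i j => Q j i) => [i j|y Qy]; first by have := Qx j i; rewrite mxE.
by apply: QA => i j; rewrite mxE; exact: Qy.
Qed.

Lemma lsc_add_sqnorm h (c : R) v : 0 <= c -> (forall u, (-oo < h u)%E) ->
  lower_semicontinuous h ->
  lower_semicontinuous (fun u => h u + (c * sqnorm (u - v))%:E)%E.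
Proof.
move=> c0 hN lsch x a hax.
have [b [e [e0 hb hab]]] : exists b e : R,
    [/\ 0 < e, (b%:E < h x)%E & a <= b + c * sqnorm (x - v) - e].
  move: hax (hN x); case: (h x) => [b| |]// hax _; last first.
    by exists (a - c * sqnorm (x - v) + 1), 1; split; rewrite ?ltry//; lra.
  move: hax; rewrite -EFinD lte_fin => hax.
  pose e := (b + c * sqnorm (x - v) - a) / 2.
  exists (b - e), e; split; rewrite ?lte_fin /e; lra.
have [V Vx hV] := lsch x b hb.
pose C := \sum_(i < l) `|(x - v) i 0|.
have C0 : 0 <= C by apply: sumr_ge0.
have d0 : 0 < e / (c * (2 * C) + 1).
  by rewrite divr_gt0//; apply: ltr_wpDl => //; rewrite !mulr_ge0.
(* On this ball the linear term of the expanded square, at most [c * (2 * C)] times the distance,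
   costs no more than [e]; the [+ 1] keeps the denominator positive. *)
exists (V `&` ball x (e / (c * (2 * C) + 1))).
  by apply: filterI => //; apply: nbhsx_ballx.
move=> y [/hV Vy]; rewrite mx_norm_ball /ball_ /= => xy.
have dxy : `|dotv (x - v) (y - x)| <= C * `|x - y|.
  rewrite mulr_suml; apply: le_trans (ler_norm_sum _ _ _) _.
  apply: ler_sum => i _; rewrite normrM ler_wpM2l// distrC.
  exact: ((cV_norm_le (y - x) (normr_ge0 _)).1 (lexx _)).
have q : sqnorm (x - v) - 2 * C * `|x - y| <= sqnorm (y - v).
  have -> : y - v = (x - v) + (y - x) by rewrite [RHS]addrC addrA subrK.
  rewrite (sqnormD (x - v)); have := sqnorm_ge0 (y - x).
  by have := ler_norm (- dotv (x - v) (y - x)); rewrite normrN; lra.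
have cq : c * sqnorm (x - v) - e <= c * sqnorm (y - v).
  apply: le_trans (ler_wpM2l c0 q); rewrite mulrBr lerD2l lerN2 mulrA.
  have pos : 0 < c * (2 * C) + 1.
    by apply: ltr_wpDl => //; rewrite !mulr_ge0.
  move: xy; rewrite ltr_pdivlMr// => /ltW xy; apply: le_trans xy.
  have := normr_ge0 (x - y); nra.
have : (a%:E <= b%:E + (c * sqnorm (y - v))%:E)%E by rewrite -EFinD lee_fin; lra.
by move=> /le_lt_trans; apply; rewrite lteD2rE.
Qed.

(* A strong enough quadratic penalty pushes the minimizer over the unit ball
   into its interior, which yields a subgradient, i.e. an affine minorant. *)
Lemma conjugate_proper h : proper_lsc_convex h -> proper (conjugate h).
Proof.
move=> [ph lsch ch]; have [[u0 u0d] hN] := ph; split; last first.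
  move=> v; have [b hb] := proper_domE ph u0d.
  apply: (@lt_le_trans _ _ (dotv u0 v - b)%:E); first by rewrite ltNyr.
  by apply: ereal_sup_ubound; exists u0 => //; rewrite hb.
have [a0 ha0] := proper_domE ph u0d.
pose K : set 'cV[R]_l := [set v | `|v - u0| <= 1].
have Ku0 : K u0 by rewrite /K /= subrr normr0.
have cK : compact K by exact: cV_ball_compact.
have [um Kum minm] := lsc_compact_min lsch cK (ex_intro _ _ Ku0).
have [am ham] : exists am, h um = am%:E.
  by apply: proper_domE => //; rewrite /dom /=; apply: le_lt_trans (minm _ Ku0) _.
have am0 : am <= a0 by have := minm _ Ku0; rewrite ham ha0 lee_fin.
(* On the unit sphere [h] is at least [am] and the squared norm at least 1, so the penalized value
   is at least [a0 + 1] there, above the value [a0] at the centre. *)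
pose c := a0 - am + 1; have c0 : 0 <= c by rewrite /c; lra.
have [u Ku minu] := lsc_compact_min (@lsc_add_sqnorm h c u0 c0 hN lsch)
  cK (ex_intro _ _ Ku0).
have := minu _ Ku0; rewrite subrr sqnorm0 mulr0 adde0 ha0 => hu0.
have [a ha] : exists a, h u = a%:E.
  apply: proper_domE => //; rewrite /dom /=.
  by move: hu0; case: (h u) => [b| |]//=; rewrite ltry.
have u1 : `|u - u0| < 1.
  rewrite lt_def Ku andbT; apply/eqP => n1.
  have [[i j] /=] : exists i, mx_norm (u - u0) = `|(u - u0) i.1 i.2|.
    by apply: mx_norm_neq0; rewrite -[mx_norm _]n1 oner_eq0.
  rewrite [mx_norm _](esym n1) ord1 => n2.
  have : 1 <= sqnorm (u - u0).
    rewrite /sqnorm /dotv (bigD1 i)//= -expr2 -real_normK ?num_real// -n2 expr1n.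
    by rewrite lerDl sumr_ge0// => k _; rewrite -expr2 sqr_ge0.
  move: hu0 (minm _ Ku); rewrite ha ham -EFinD !lee_fin => h1 h2 h3.
  have : c * 1 <= c * sqnorm (u - u0) by rewrite ler_wpM2l.
  by rewrite /c in h1 *; lra.
have sub : subdiff h u ((2 * c) *: (u0 - u)).
  apply: local_argmin_subdiff => //; first by rewrite /dom /= ha ltry.
  move=> w; have d0 : 0 < (1 - `|u - u0|) / (`|w - u| + 1).
    by rewrite divr_gt0 ?subr_gt0// ltr_wpDl.
  (* The distance from [u] to the sphere limits the step, so that the segment towards [w] stays in
     the ball. *)
  exists ((1 - `|u - u0|) / (`|w - u| + 1)) => // s /andP[s0 s1].
  apply: minu; rewrite /K /= addrAC; apply: le_trans (ler_normD _ _) _.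
  rewrite normrZ gtr0_norm//; move: s1; rewrite ltr_pdivlMr; last by rewrite ltr_wpDl.
  by have := normr_ge0 (w - u); nra.
exists ((2 * c) *: (u0 - u)); rewrite /dom /=.
apply: (@le_lt_trans _ _ (dotv u ((2 * c) *: (u0 - u)) - a)%:E); last exact: ltry.
apply: ge_ereal_sup => _ [w _ <-]; have := sub w; rewrite ha.
case: (h w) => [b| |]//; rewrite ?leNye// -!EFinD !lee_fin.
by rewrite (dotvC w) (dotvC u) dotvDr dotvNr; lra.
Qed.

End Conjugate.

(** * Separable sums *)

Lemma submxcolZ (R : pzRingType) (n : nat) (dim : 'I_n -> nat) (a : R)
    (B : 'cV[R]_(\sum_i dim i)) i :
  submxcol (a *: B) i = a *: submxcol B i.
Proof. by apply/matrixP => j k; rewrite !mxE. Qed.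

Section SeparableConjugate.
Context {R : realType} {n : nat} {dim : 'I_n -> nat}.
Notation Y := 'cV[R]_(\sum_i dim i).
Variable f : forall i, 'cV[R]_(dim i) -> \bar R.
Arguments f : clear implicits.
Hypothesis pf : forall i, proper (f i).
Implicit Types (y v w : Y).

Lemma conjugate_fsum_ge y (b : 'I_n -> R) (u : forall i, 'cV[R]_(dim i)) :
  (forall i, f i (u i) = (b i)%:E) ->
  ((\sum_i (dotv (u i) (submxcol y i) - b i))%:E <= conjugate (fsum f) y)%E.
Proof.
move=> fu; apply: ereal_sup_ubound; exists (\mxcol_i u i) => //.
rewrite /fsum (eq_bigr (fun i => (b i)%:E)); last by move=> i _; rewrite mxcolK.
rewrite sumEFin -EFinB dotv_blocks -sumrB.
by congr (_%:E); apply: eq_bigr => i _; rewrite mxcolK.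
Qed.

Lemma fsum_dom : exists u : forall i, 'cV[R]_(dim i),
  exists b : 'I_n -> R, forall i, f i (u i) = (b i)%:E.
Proof.
exists (fun i => projT1 (cid (pf i).1)).
exists (fun i => fine (f i (projT1 (cid (pf i).1)))) => i.
by case: cid => u /= /(proper_domE (pf i)) [b ->].
Qed.

(** The blocks of the maximization variable are independent. For the bound on the sum of conjugates,
    a finite joint supremum forces each block conjugate to be finite, and blockwise near-maximizers
    are glued together. *)
Lemma conjugate_fsum y :
  conjugate (fsum f) y = (\sum_i conjugate (f i) (submxcol y i))%E.
Proof.
apply/eqP; rewrite eq_le; apply/andP; split.
  apply: ge_ereal_sup => _ [u _ <-].
  have [[i fi]|nfi] := pselect (exists i, f i (submxcol u i) = +oo%E).
    suff -> : fsum f u = +oo%E by rewrite leNye.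
    apply/esum_eqyP; last by exists i; rewrite mem_index_enum.
    by move=> j _; rewrite gt_eqF// (pf j).2.
  have fE i : f i (submxcol u i) = (fine (f i (submxcol u i)))%:E.
    have [|b ->//] := @proper_domE _ _ _ (submxcol u i) (pf i).
    by rewrite /Defs.dom /= ltey; apply/eqP => fi; apply: nfi; exists i.
  rewrite /fsum (eq_bigr _ (fun i _ => fE i)) sumEFin -EFinB dotv_blocks -sumrB.
  rewrite -sumEFin; apply: lee_sum => i _.
  by apply: ereal_sup_ubound; exists (submxcol u i); rewrite // fE EFinB.
have [u0 [b0 fu0]] := fsum_dom.
have [|] := ltP (conjugate (fsum f) y) +oo%E; last first.
  by rewrite leye_eq => /eqP ->; rewrite leey.
have := conjugate_fsum_ge y fu0.
case M_eq : (conjugate (fsum f) y) => [M| |]// _ _.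
have cfin i : exists c, conjugate (f i) (submxcol y i) = c%:E.
  (* Freezing the other blocks at points where [f j] is finite turns the bound on the joint supremum
     into a bound on block [i]. *)
  pose K := \sum_(j | j != i) (dotv (u0 j) (submxcol y j) - b0 j).
  have : (conjugate (f i) (submxcol y i) <= (M - K)%:E)%E.
    apply: ge_ereal_sup => _ [v _ <-].
    case fv : (f i v) => [b| |]; last 2 first.
    - by rewrite leNye.
    - by have := (pf i).2 v; rewrite fv.
    have := @conjugate_fsum_ge y (fun j => if j == i then b else b0 j)
      (dfwith u0 i v).
    rewrite M_eq -EFinB !lee_fin (bigD1 i)//= dfwithin eqxx.
    rewrite (eq_bigr (fun j => dotv (u0 j) (submxcol y j) - b0 j)).
      rewrite lerBrDr; apply => j; case: (eqVneq j i) => [ji|ji].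
        by case: _ / (esym ji) in v fv *; rewrite dfwithin.
      by rewrite dfwithout 1?eq_sym.
    by move=> j ji; rewrite (negbTE ji) dfwithout// eq_sym.
  have : ((dotv (u0 i) (submxcol y i) - b0 i)%:E
          <= conjugate (f i) (submxcol y i))%E.
    by apply: ereal_sup_ubound; exists (u0 i); rewrite // fu0 EFinB.
  by case: (conjugate _ _) => [c| |]// _ _; exists c.
pose c i := projT1 (cid (cfin i)).
have cE i : conjugate (f i) (submxcol y i) = (c i)%:E.
  by rewrite /c; case: cid.
rewrite (eq_bigr _ (fun i _ => cE i)) sumEFin lee_fin.
apply/ler_addgt0Pr => e e0.
(* The tolerance [e] is split into [n + 1] parts, a positive denominator even for [n = 0]. *)
have n1 : 0 < n%:R + 1 :> R by rewrite ltr_wpDl.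
have approx i : exists (v : 'cV[R]_(dim i)) b, f i v = b%:E /\
    c i - e / (n%:R + 1) <= dotv v (submxcol y i) - b.
  have [||_ [v _ <-]] := @ub_ereal_sup_adherent R
      [set ((dotv u (submxcol y i))%:E - f i u)%E | u in setT] (e / (n%:R + 1)).
  - by rewrite divr_gt0.
  - by rewrite -/(conjugate (f i) (submxcol y i)) cE.
  rewrite -/(conjugate (f i) (submxcol y i)) cE.
  have := (pf i).2 v; case fv : (f i v) => [b| |]// _.
  by rewrite -!EFinB lte_fin => /ltW h; exists v, b.
pose v i := projT1 (cid (approx i)).
have [b hb] : exists b : 'I_n -> R, forall i, f i (v i) = (b i)%:E /\
    c i - e / (n%:R + 1) <= dotv (v i) (submxcol y i) - b i.
  exists (fun i => projT1 (cid (projT2 (cid (approx i))))) => i.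
  by rewrite /v; case: (cid (approx i)) => /= w hw; case: cid.
have := conjugate_fsum_ge y (fun i => (hb i).1).
rewrite M_eq lee_fin => hM; rewrite -lerBlDr; apply: le_trans hM.
apply: le_trans (ler_sum _ (fun i _ => (hb i).2)).
rewrite sumrB lerD2l lerN2 sumr_const card_ord -[leLHS]mulr_natl mulrCA ger_pMr//.
by rewrite ler_pdivrMr// mul1r lerDl.
Qed.

Hypothesis pcf : forall i, proper (conjugate (f i)).

Lemma conjugate_fsum_proper : proper (conjugate (fsum f)).
Proof.
split; last first.
  move=> y; rewrite conjugate_fsum ltNye; apply/eqP => /esum_eqNyP[i [_ _ ci]].
  by have := (pcf i).2 (submxcol y i); rewrite ci.
exists (\mxcol_i projT1 (cid (pcf i).1)).
rewrite /Defs.dom /= conjugate_fsum; apply: lte_sum_pinfty => i _.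
by rewrite mxcolK; case: cid.
Qed.

(** The conjugate is separable. A competitor that differs from [y] only in block [i] isolates that
    block, since the other terms are finite and cancel. *)
Lemma subdiff_conjugate_fsum y v :
  subdiff (conjugate (fsum f)) y v <->
  forall i, subdiff (conjugate (f i)) (submxcol y i) (submxcol v i).
Proof.
split=> [s i w|s w]; last first.
  rewrite !conjugate_fsum dotv_blocks -sumEFin -big_split /=.
  by apply: lee_sum => i _; rewrite submxcolB; exact: s.
have [a] := proper_domE conjugate_fsum_proper (subdiff_dom conjugate_fsum_proper s).
rewrite conjugate_fsum => ya.
have cfin j : exists c, conjugate (f j) (submxcol y j) = c%:E.
  apply: (proper_domE (pcf j)); rewrite /Defs.dom /= ltey; apply/eqP => yj.
  suff : (\sum_i conjugate (f i) (submxcol y i))%E = +oo%E by rewrite ya.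
  apply/esum_eqyP; last by exists j; rewrite mem_index_enum.
  by move=> k _; rewrite gt_eqF// (pcf k).2.
pose c j := projT1 (cid (cfin j)).
have cE j : conjugate (f j) (submxcol y j) = (c j)%:E.
  by rewrite /c; case: cid.
have [|] := ltP (conjugate (f i) w) +oo%E; last first.
  by rewrite leye_eq => /eqP ->; rewrite leey.
move=> /(proper_domE (pcf i))[b wb].
have := s (\mxcol_j dfwith (submxcol y) i w j).
rewrite !conjugate_fsum dotv_blocks (bigD1 i)//= [X in (_ + X%:E <= _)%E](bigD1 i)//=.
rewrite [X in (_ <= X)%E](bigD1 i)//= submxcolB !mxcolK dfwithin cE wb.
rewrite [X in (_ + (_ + X)%:E <= _)%E]big1 ?addr0; last first.
  move=> j ji; rewrite submxcolB mxcolK dfwithout 1?eq_sym// subrr.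
  by rewrite -(scale0r 0) dotvZr mul0r.
rewrite (eq_bigr (fun j => (c j)%:E)); last by move=> j _.
rewrite [X in (_ <= _ + X)%E](eq_bigr (fun j => (c j)%:E)); last first.
  by move=> j ji; rewrite mxcolK dfwithout 1?eq_sym.
by rewrite !sumEFin -!EFinD !lee_fin; lra.
Qed.

Context {m : nat}.
Variables (A : forall i, 'M[R]_(dim i, m)) (g : 'cV[R]_m -> \bar R).

Lemma submxcol_stack (x : 'cV[R]_m) i : submxcol (stack A *m x) i = A i *m x.
Proof. by rewrite -submxcol_mul mxcolK. Qed.

Lemma Zstar_subdiff (x : 'cV[R]_m) y : Zstar A f g (x, y) ->
  subdiff g x (- ((stack A)^T *m y)) /\
  forall i, subdiff (conjugate (f i)) (submxcol y i) (A i *m x).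
Proof.
move=> [u [v [su sv]]] /= /esym [/eqP h1 /eqP h2].
move: h1 h2 su sv; rewrite addr_eq0 subr_eq0 => /eqP -> /eqP -> su.
by move=> /subdiff_conjugate_fsum sv; split=> // i; rewrite -submxcol_stack.
Qed.

Lemma KKT_subdiff (x : 'cV[R]_m) y u v : subdiff g x u ->
  (forall i, subdiff (conjugate (f i)) (submxcol y i) (submxcol v i)) ->
  KKT A f g (x, y) (u + (stack A)^T *m y, v - stack A *m x).
Proof. by move=> su sv; exists u, v; split=> //; apply/subdiff_conjugate_fsum. Qed.

End SeparableConjugate.

(** * One step of the algorithm *)

Section Lyapunov.
Context {R : realType} {n m : nat} {dim : 'I_n -> nat}.
Notation X := 'cV[R]_m.
Notation Y := 'cV[R]_(\sum_i dim i).
Variables (A : forall i, 'M[R]_(dim i, m)) (p sigma : 'I_n -> R) (tau gamma : R).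
Hypotheses (hp0 : forall i, 0 < p i) (hp1 : \sum_i p i = 1).
Hypothesis hstep : step_sizes A p sigma tau gamma.
Implicit Types (x : X) (y dy : Y).

(* [Vk] with the dual increment [y k - y k.-1] replaced by an arbitrary [dy]. *)
Definition lyap dy (z : X * Y) : R :=
  2^-1 * sqnormX tau z.1
  - dotv (stack A *m z.1) (scale_blocks (fun j => (p j)^-1) dy)
  + 2^-1 * sqnormYP sigma p dy + 2^-1 * sqnormYP sigma p z.2.

Definition update_block (i : 'I_n) y (yhat : Y) : Y :=
  \mxcol_j (if j == i then submxcol yhat j else submxcol y j).

Definition single_block dy := exists i, forall j, j != i -> submxcol dy j = 0.

Lemma cross_blocks x y :
  dotv (stack A *m x) (scale_blocks (fun j => (p j)^-1) y) =
  \sum_j (p j)^-1 * dotv (A j *m x) (submxcol y j).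
Proof.
rewrite dotv_blocks; apply: eq_bigr => j _.
by rewrite submxcol_stack mxcolK dotvZr.
Qed.

Lemma sqnormYPE y :
  sqnormYP sigma p y = \sum_j (sigma j)^-1 * (p j)^-1 * sqnorm (submxcol y j).
Proof. by []. Qed.

Lemma sqnormYE y : sqnormY sigma y = \sum_j (sigma j)^-1 * sqnorm (submxcol y j).
Proof. by []. Qed.

(** Block [j] takes its new value with probability [p j] and keeps the old one otherwise, so a
    separable quantity averages block by block. *)
Lemma average_update (F : forall j, 'cV[R]_(dim j) -> R) y yhat :
  \sum_i p i * (\sum_j F j (submxcol (update_block i y yhat) j)) =
  \sum_j (F j (submxcol y j)
          + p j * (F j (submxcol yhat j) - F j (submxcol y j))).
Proof.
under eq_bigr do rewrite mulr_sumr.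
rewrite exchange_big; apply: eq_bigr => j _ /=.
rewrite (bigD1 j)//= mxcolK eqxx.
rewrite (eq_bigr (fun i => p i * F j (submxcol y j))); last first.
  by move=> i ij; rewrite mxcolK eq_sym (negbTE ij).
rewrite -mulr_suml; have -> : \sum_(i | i != j) p i = 1 - p j.
  by have := hp1; rewrite (bigD1 j)//=; lra.
by ring.
Qed.

Lemma average_update_affine (c : R) (F : forall j, 'cV[R]_(dim j) -> R) y yhat :
  \sum_i p i * (c + \sum_j F j (submxcol (update_block i y yhat) j)) =
  c + \sum_j (F j (submxcol y j)
          + p j * (F j (submxcol yhat j) - F j (submxcol y j))).
Proof.
rewrite -average_update -[c in RHS]mul1r -hp1 mulr_suml -big_split /=.
by apply: eq_bigr => i _; rewrite mulrDr.
Qed.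

Lemma update_block_single i y yhat : single_block (update_block i y yhat - y).
Proof.
by exists i => j /negbTE ji; rewrite submxcolB mxcolK ji subrr.
Qed.

Let tau0 : 0 < tau. Proof. by case: hstep. Qed.
Let sigma0 i : 0 < sigma i. Proof. by case: hstep. Qed.
Let gamma0 : 0 <= gamma < 1. Proof. by case: hstep. Qed.

Lemma enorm_mulmx_le (k l : nat) (B : 'M[R]_(k, l)) u :
  enorm (B *m u) <= opnorm enorm enorm (mulmx B) * enorm u.
Proof.
have [c c0 bB] := sqnorm_mulmx_le B.
apply: (@le_opnorm _ _ _ _ _ _ *:%R (Num.sqrt c)); rewrite ?sqrtr_ge0//.
- exact: enorm_ge0.
- by move=> v; rewrite /enorm -sqrtrM// ler_wsqrtr.
- by move=> a v a0; rewrite enormZ ger0_norm.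
- by move=> a v a0; rewrite -scalemxAr enormZ ger0_norm.
Qed.

(* The step-size condition is blockwise: it controls the cross term only because
   a single block of the dual increment is nonzero. *)
Lemma cross_term_le x dy : single_block dy ->
  `|dotv (stack A *m x) (scale_blocks (fun j => (p j)^-1) dy)|
  <= gamma / 2 * (sqnormX tau x + sqnormYP sigma p dy).
Proof.
move=> [a dy0]; rewrite cross_blocks sqnormYPE.
have z j : j != a -> submxcol dy j = 0 *: submxcol dy j.
  by move=> /dy0 ->; rewrite scale0r.
rewrite (bigD1 a)//= big1 ?addr0; last first.
  by move=> j /z ->; rewrite dotvZr mul0r mulr0.
rewrite [X in _ * (_ + X)](bigD1 a)//= big1 ?addr0; last first.
  by move=> j /z ->; rewrite sqnormZ expr0n mul0r mulr0.
have [_ _ _ /(_ a) hs] := hstep.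
have /andP[g0 g1] := gamma0.
have s0 := sigma0 a; have pa0 := hp0 a.
set d := submxcol dy a; rewrite /sqnormX.
have L : dotv (A a *m x) d ^+ 2 <=
    opnorm enorm enorm (mulmx (A a)) ^+ 2 * sqnorm x * sqnorm d.
  apply: le_trans (dotv_sqr_le _ _) _; rewrite ler_wpM2r ?sqnorm_ge0//.
  rewrite -!sqr_enorm -exprMn lerXn2r ?nnegrE ?enorm_ge0//; last exact: enorm_mulmx_le.
  exact: le_trans (enorm_ge0 _) (enorm_mulmx_le _ _).
rewrite -ler_sqr ?nnegrE//; last first.
  by rewrite !(mulr_ge0, addr_ge0)// ?sqnorm_ge0// ?invr_ge0 ltW.
rewrite real_normK ?num_real//.
have u0 : 0 <= tau^-1 * sqnorm x by rewrite mulr_ge0 ?sqnorm_ge0// invr_ge0 ltW.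
have v0 : 0 <= (sigma a)^-1 * (p a)^-1 * sqnorm d.
  by rewrite !mulr_ge0 ?sqnorm_ge0// invr_ge0 ltW.
(* The intermediate bound is below the right side by Young's inequality, the difference being a
   perfect square, and above the left side by the step-size condition of block [a]. *)
apply: (@le_trans _ _ (gamma ^+ 2 * (tau^-1 * sqnorm x)
                       * ((sigma a)^-1 * (p a)^-1 * sqnorm d))); last first.
  rewrite -subr_ge0; set u := tau^-1 * _; set v := _ * sqnorm d.
  have -> : (gamma / 2 * (u + v)) ^+ 2 - gamma ^+ 2 * u * v =
    (gamma / 2 * (u - v)) ^+ 2 by field.
  exact: sqr_ge0.
rewrite exprMn; apply: (@le_trans _ _ ((p a)^-1 ^+ 2 *
    (opnorm enorm enorm (mulmx (A a)) ^+ 2 * sqnorm x * sqnorm d))).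
  by rewrite ler_wpM2l// sqr_ge0.
have -> : (p a)^-1 ^+ 2 *
    (opnorm enorm enorm (mulmx (A a)) ^+ 2 * sqnorm x * sqnorm d) =
    ((p a)^-1 * tau * sigma a * opnorm enorm enorm (mulmx (A a)) ^+ 2) *
    ((tau^-1 * sqnorm x) * ((sigma a)^-1 * (p a)^-1 * sqnorm d)).
  by field; rewrite !lt0r_neq0.
by rewrite -[leRHS]mulrA ler_wpM2r// mulr_ge0.
Qed.

Lemma sqnormX_ge0 x : 0 <= sqnormX tau x.
Proof. by rewrite mulr_ge0 ?sqnorm_ge0// invr_ge0 ltW. Qed.

Lemma sqnormYP_ge0 y : 0 <= sqnormYP sigma p y.
Proof. by apply: sumr_ge0 => i _; rewrite !mulr_ge0 ?sqnorm_ge0// invr_ge0 ltW. Qed.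

Lemma sqnormY_ge0 y : 0 <= sqnormY sigma y.
Proof. by apply: sumr_ge0 => i _; rewrite !mulr_ge0 ?sqnorm_ge0// invr_ge0 ltW. Qed.

Lemma lyap_ge dy x y : single_block dy ->
  (1 - gamma) / 2 * sqnormX tau x + 2^-1 * sqnormYP sigma p y <= lyap dy (x, y).
Proof.
move=> /(cross_term_le x); rewrite ler_norml /lyap /= => /andP[_ h].
by have := sqnormYP_ge0 dy; have /andP[] := gamma0; nra.
Qed.

Lemma lyap_le dy x y : single_block dy ->
  lyap dy (x, y) <= sqnormX tau x + sqnormYP sigma p dy + 2^-1 * sqnormYP sigma p y.
Proof.
move=> /(cross_term_le x); rewrite ler_norml /lyap /= => /andP[h _].
have := sqnormYP_ge0 dy; have := sqnormX_ge0 x; have /andP[] := gamma0; nra.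
Qed.

Lemma V_ge x dy : single_block dy ->
  (1 - gamma) / 2 * (sqnormX tau x + sqnormYP sigma p dy) <= V A p sigma tau (x, dy).
Proof.
move=> /(cross_term_le x); rewrite ler_norml /V /= => /andP[h _].
by lra.
Qed.

(** Blockwise form of the primal monotonicity gap. The extrapolated dual point is written out so
    that its [(p j)^-1] term can be matched with the cross terms of [lyap] and [V]. *)
Lemma primal_gap (xs : X) (ys : Y) xp yp x y :
  dotv (tau^-1 *: (xp - tau *: ((stack A)^T *m
      (y + scale_blocks (fun j => (p j)^-1) (y - yp))) - x)
    - (- ((stack A)^T *m ys))) (x - xs) =
  tau^-1 * dotv (xp - x) (x - xs)
  - \sum_j dotv (A j *m (x - xs))
     (submxcol (y - ys) j + (p j)^-1 *: submxcol (y - yp) j).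
Proof.
rewrite opprK addrAC scalerBr scalerA mulVf ?lt0r_neq0// scale1r -addrA.
rewrite dotvDl dotvZl; congr (_ + _).
rewrite addrC -mulmxBr dotvC -adjoint_stack -[ys - _]opprB dotvNr.
rewrite dotv_blocks; congr (- _); apply: eq_bigr => j _.
by rewrite submxcol_stack [y + _ - ys]addrAC (submxcolD (y - ys)) mxcolK.
Qed.

(* The difference of the two sides is the sum of the two monotonicity gaps. *)
Lemma expected_decrease (xs : X) (ys : Y) xp yp x y yhat :
  0 <= dotv (tau^-1 *: (xp - tau *: ((stack A)^T *m
      (y + scale_blocks (fun j => (p j)^-1) (y - yp))) - x)
    - (- ((stack A)^T *m ys))) (x - xs) ->
  (forall j, 0 <= dotv ((sigma j)^-1 *: (submxcol y j + sigma j *: (A j *m x)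
        - submxcol yhat j) - A j *m xs) (submxcol yhat j - submxcol ys j)) ->
  \sum_i p i * lyap (update_block i y yhat - y) (x - xs, update_block i y yhat - ys)
  <= lyap (y - yp) (xp - xs, y - ys) - V A p sigma tau (x - xp, y - yp).
Proof.
move=> hP hD; rewrite primal_gap in hP.
have {}hD : 0 <= \sum_j ((sigma j)^-1 * dotv (submxcol y j - submxcol yhat j)
      (submxcol yhat j - submxcol ys j)
    + dotv (A j *m (x - xs)) (submxcol yhat j - submxcol ys j)).
  apply: sumr_ge0 => j _; apply: le_trans (hD j) _.
  rewrite le_eqVlt; apply/orP; left; apply/eqP.
  by rewrite mulmxBr !dotv_lin; field; rewrite lt0r_neq0.
(* The contribution of block [j] to [lyap] as a function of the updated block alone, so that
   [average_update_affine] applies. *)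
pose F j (v : 'cV[R]_(dim j)) :=
  - ((p j)^-1 * dotv (A j *m (x - xs)) (v - submxcol y j))
  + 2^-1 * ((sigma j)^-1 * (p j)^-1 * sqnorm (v - submxcol y j))
  + 2^-1 * ((sigma j)^-1 * (p j)^-1 * sqnorm (v - submxcol ys j)).
rewrite (eq_bigr (fun i => p i * (2^-1 * sqnormX tau (x - xs)
    + \sum_j F j (submxcol (update_block i y yhat) j)))); last first.
  move=> i _; congr (_ * _); rewrite /lyap /= cross_blocks !sqnormYPE.
  rewrite !mulr_sumr -sumrN -!addrA -!big_split /=; congr (_ + _).
  by apply: eq_bigr => j _; rewrite !submxcolB /F addrA.
rewrite average_update_affine /lyap /V /= !cross_blocks.
rewrite -subr_ge0; apply: le_trans (addr_ge0 hP hD) _.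
rewrite -[X in _ <= X - _]addrA.
set S1 := \sum_j (F _ _ + _).
set S2 := \sum_j _ * dotv (A j *m (xp - xs)) _.
set S3 := \sum_j _ * dotv (A j *m (x - xp)) _.
set S4 := \sum_j dotv _ _.
set S5 := \sum_j (_ + _).
rewrite /sqnormX.
(* Three-point identity for the primal distances; what remains is an identity between dual terms
   that holds in each block separately. *)
have -> : 2^-1 * (tau^-1 * sqnorm (xp - xs)) = 2^-1 * (tau^-1 * sqnorm (x - xs))
    + tau^-1 * dotv (xp - x) (x - xs) + 2^-1 * (tau^-1 * sqnorm (x - xp)).
  have -> : xp - xs = (xp - x) + (x - xs) by rewrite addrA subrK.
  by rewrite (sqnormD (xp - x)) (sqnormBC x xp); field; rewrite lt0r_neq0.
suff : S5 - S4 = 2^-1 * sqnormYP sigma p (y - ys) - S1 - S2 - S3 by lra.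
rewrite sqnormYPE /S5 /S4 /S1 /S2 /S3 mulr_sumr -!sumrB; apply: eq_bigr => j _.
rewrite /F !submxcolB.
set a := A j *m (x - xs).
have -> : A j *m (xp - xs) = a - A j *m (x - xp).
  by rewrite -mulmxBr; congr (_ *m _); rewrite opprB [RHS]addrC addrA subrK.
set b := A j *m (x - xp).
set yj := submxcol y j; set sj := submxcol ys j; set hj := submxcol yhat j.
set dj := submxcol yp j.
have -> : hj - sj = (hj - yj) + (yj - sj) by rewrite addrA subrK.
rewrite subrr sqnorm0 -(opprB hj yj) -(scale0r 0).
move: (hj - yj) (yj - sj) (yj - dj) => h w d.
rewrite (sqnormD h) !dotv_lin -/(sqnorm h).
by field; rewrite !lt0r_neq0.
Qed.

(** The factor [pmin] brings the weights [(p j)^-1] below 1. The error of a block left unchanged is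
    traded for that of [yhat] by the triangle inequality, at the price of the term in [yhat - y]. *)
Lemma expected_lyap_le (pmin : R) x y yhat (xt : X) (yt : Y) :
  0 <= pmin -> (forall j, pmin <= p j) ->
  pmin * (\sum_i p i * lyap (update_block i y yhat - y)
                         (x - xt, update_block i y yhat - yt))
  <= sqnormX tau (x - xt) + sqnormY sigma (yhat - yt) + 2 * sqnormY sigma (yhat - y).
Proof.
move=> pm0 pmp.
pose F j (v : 'cV[R]_(dim j)) := (sigma j)^-1 * (p j)^-1 * sqnorm (v - submxcol y j)
  + 2^-1 * ((sigma j)^-1 * (p j)^-1 * sqnorm (v - submxcol yt j)).
have h1 : \sum_i p i * lyap (update_block i y yhat - y)
                         (x - xt, update_block i y yhat - yt) <=
   \sum_i p i * (sqnormX tau (x - xt)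
      + \sum_j F j (submxcol (update_block i y yhat) j)).
  apply: ler_sum => i _; rewrite ler_pM2l//.
  apply: le_trans (lyap_le _ _ (update_block_single _ _ _)) _.
  rewrite -addrA lerD2l !sqnormYPE mulr_sumr -big_split /=.
  by apply: ler_sum => j _; rewrite !submxcolB.
apply: le_trans (ler_wpM2l pm0 h1) _; rewrite average_update_affine.
have p1 : pmin <= 1.
  have [j _|n0] := pickP 'I_n; last first.
    by move: hp1; rewrite big_pred0// => /esym/eqP; rewrite oner_eq0.
  apply: le_trans (pmp j) _; rewrite -hp1 (bigD1 j)//= lerDl.
  by apply: sumr_ge0 => i _; rewrite ltW.
rewrite mulrDr -addrA; apply: lerD; first by rewrite ler_piMl// sqnormX_ge0.
rewrite !sqnormYE !mulr_sumr -big_split /=; apply: ler_sum => j _.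
rewrite /F !submxcolB subrr sqnorm0.
set yj := submxcol y j; set tj := submxcol yt j; set hj := submxcol yhat j.
have hY : sqnorm (yj - tj) <= 2 * sqnorm (hj - yj) + 2 * sqnorm (hj - tj).
  have -> : yj - tj = (yj - hj) + (hj - tj) by rewrite addrA subrK.
  by rewrite (sqnormBC hj yj) sqnormD_le.
have pj0 := hp0 j; have sj0 := sigma0 j; have pj := pmp j.
have -> : pmin * ((sigma j)^-1 / p j * 0 +
  2^-1 * ((sigma j)^-1 / p j * sqnorm (yj - tj)) +
  p j * ((sigma j)^-1 / p j * sqnorm (hj - yj) +
    2^-1 * ((sigma j)^-1 / p j * sqnorm (hj - tj)) -
    ((sigma j)^-1 / p j * 0 + 2^-1 * ((sigma j)^-1 / p j * sqnorm (yj - tj))))) =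
  (sigma j)^-1 * (pmin / p j * (2^-1 * sqnorm (yj - tj)) +
    pmin * (sqnorm (hj - yj) + 2^-1 * sqnorm (hj - tj) - 2^-1 * sqnorm (yj - tj))).
  by field; rewrite !lt0r_neq0.
rewrite [X in _ <= _ + X]mulrCA -mulrDr ler_wpM2l//; first by rewrite invr_ge0 ltW.
have q1 : pmin / p j <= 1 by rewrite ler_pdivrMr// mul1r.
have := ler_wpM2r (sqnorm_ge0 (yj - tj)) q1.
move: (sqnorm_ge0 (hj - yj)) (sqnorm_ge0 (hj - tj)) (sqnorm_ge0 (yj - tj)) hY.
move: (sqnorm (hj - yj)) (sqnorm (hj - tj)) (sqnorm (yj - tj)) => a b c a0 b0 c0 hY.
move: (pmin / p j) => q hq.
have h2 : 0 <= (1 - pmin) * (2 * a + 2 * b - c) by rewrite mulr_ge0; lra.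
have h3 := mulr_ge0 pm0 b0.
by lra.
Qed.

End Lyapunov.

(** * The operator H - M *)

Section OperatorNormHM.
Context {R : realType} {n m : nat} {dim : 'I_n -> nat}.
Notation X := 'cV[R]_m.
Notation Y := 'cV[R]_(\sum_i dim i).
Variables (A : forall i, 'M[R]_(dim i, m)) (p sigma : 'I_n -> R) (tau : R).
Hypotheses (hp0 : forall i, 0 < p i) (tau0 : 0 < tau).
Hypothesis sigma0 : forall i, 0 < sigma i.
Implicit Types (x : X) (y : Y).

Lemma sqnorm_blocks y : sqnorm y = \sum_j sqnorm (submxcol y j).
Proof. exact: dotv_blocks. Qed.

Lemma sqnorm_keep_block i y : sqnorm (keep_block i y) <= sqnorm y.
Proof.
rewrite !sqnorm_blocks; apply: ler_sum => j _; rewrite mxcolK.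
by case: eqP => // _; rewrite sqnorm0 sqnorm_ge0.
Qed.

Lemma le_sum_pos (a : 'I_n -> R) j : (forall i, 0 <= a i) -> a j <= \sum_i a i.
Proof. by move=> a0; rewrite (bigD1 j)//= lerDl sumr_ge0. Qed.

Lemma sqnorm_le_sqnormY y : sqnorm y <= (\sum_i sigma i) * sqnormY sigma y.
Proof.
rewrite sqnorm_blocks mulr_sumr; apply: ler_sum => j _.
rewrite mulrA ler_peMl ?sqnorm_ge0// ler_pdivlMr// mul1r.
by apply: le_sum_pos => i; rewrite ltW.
Qed.

Lemma sqnormY_le_sqnorm y : sqnormY sigma y <= (\sum_i (sigma i)^-1) * sqnorm y.
Proof.
rewrite sqnorm_blocks mulr_sumr; apply: ler_sum => j _.
rewrite ler_wpM2r ?sqnorm_ge0//.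
by apply: (@le_sum_pos (fun i => (sigma i)^-1)) => i; rewrite invr_ge0 ltW.
Qed.

Lemma sqnorm_scale_blocks (a : 'I_n -> R) y : (forall i, 0 <= a i) ->
  sqnorm (scale_blocks a y) <= (\sum_i a i) ^+ 2 * sqnorm y.
Proof.
move=> a0; rewrite !sqnorm_blocks mulr_sumr; apply: ler_sum => j _.
rewrite mxcolK sqnormZ ler_wpM2r ?sqnorm_ge0//.
by rewrite lerXn2r ?nnegrE ?sumr_ge0// le_sum_pos.
Qed.

(** Finiteness of the operator norm: it makes the real [sup] in [normHM] a true upper bound. No
    sharp constant is sought. *)
Lemma HMop_bounded : exists2 c : R, 0 <= c & forall q : ZZ,
  normZZ p sigma tau (HMop A p sigma tau q) <= c * normZZ p sigma tau q.
Proof.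
have [c1 c10 hA] := sqnorm_mulmx_le (stack A).
have [c2 c20 hAT] := sqnorm_mulmx_le (stack A)^T.
pose S := \sum_i sigma i; pose S' := \sum_i (sigma i)^-1.
have S0 : 0 <= S by apply: sumr_ge0 => i _; rewrite ltW.
have S'0 : 0 <= S' by apply: sumr_ge0 => i _; rewrite invr_ge0 ltW.
pose P := \sum_i (1 + (p i)^-1) ^+ 2.
have P0 : 0 <= P by apply: sumr_ge0 => i _; rewrite sqr_ge0.
pose t := tau^-1; have t0 : 0 <= t by rewrite invr_ge0 ltW.
(* The sum of all coefficients in the estimates [b1] and [b2] after weighting; the surplus products
   are nonnegative. *)
pose K := t * (2 * t) + t * (4 * (P * c2) + 4 * c2) * S
  + S' * (2 * S' ^+ 2 * S) + S' * (2 * c1 * tau).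
have tau1 := ltW tau0.
have K0 : 0 <= K by rewrite /K !(mulr_ge0, addr_ge0, sqr_ge0).
exists (Num.sqrt K); first exact: sqrtr_ge0.
move=> [qx qy]; rewrite /normZZ -sqrtrM// ler_wsqrtr// mulr_sumr.
apply: ler_sum => i _; rewrite mulrCA ler_pM2l//=.
set x := qx i; set y := qy i.
have hX : sqnorm x = tau * sqnormX tau x.
  by rewrite /sqnormX mulrA divff ?mul1r// lt0r_neq0.
have nX : 0 <= sqnormX tau x by rewrite mulr_ge0 ?sqnorm_ge0.
have nY : 0 <= sqnormY sigma y.
  by apply: sumr_ge0 => j _; rewrite mulr_ge0 ?sqnorm_ge0// invr_ge0 ltW.
have hY := sqnorm_le_sqnormY y.
have b1 : sqnorm (tau^-1 *: x + (1 + (p i)^-1) *: ((stack A)^T *m keep_block i y)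
    - (stack A)^T *m y) <=
    2 * t * sqnormX tau x + (4 * (P * c2) + 4 * c2) * S * sqnormY sigma y.
  rewrite -addrA; apply: le_trans (sqnormD_le _ _) _.
  rewrite sqnormZ hX; apply: lerD.
    rewrite le_eqVlt; apply/orP; left; apply/eqP; rewrite /t.
    by field; rewrite lt0r_neq0.
  apply: (@le_trans _ _ (2 * (2 * (P * c2 * sqnorm y) + 2 * (c2 * sqnorm y)))).
    rewrite ler_pM2l//; apply: le_trans (sqnormD_le _ _) _; rewrite sqnormN.
    apply: lerD; rewrite ler_pM2l// sqnormZ.
    rewrite -mulrA; apply: ler_pM; rewrite ?sqr_ge0 ?sqnorm_ge0//.
      by apply: (@le_sum_pos (fun i => (1 + (p i)^-1) ^+ 2)) => j; rewrite sqr_ge0.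
    by apply: le_trans (hAT _) _; rewrite ler_wpM2l// sqnorm_keep_block.
  have -> : 2 * (2 * (P * c2 * sqnorm y) + 2 * (c2 * sqnorm y)) =
    (4 * (P * c2) + 4 * c2) * sqnorm y by ring.
  rewrite -[X in _ <= X]mulrA; apply: ler_wpM2l => //.
  by rewrite addr_ge0// !mulr_ge0.
have b2 : sqnorm (scale_blocks (fun j => (sigma j)^-1) y - - (stack A *m x)) <=
    2 * S' ^+ 2 * S * sqnormY sigma y + 2 * c1 * tau * sqnormX tau x.
  rewrite opprK; apply: le_trans (sqnormD_le _ _) _; apply: lerD.
    rewrite -[2 * S' ^+ 2 * S]mulrA -[X in _ <= X]mulrA ler_pM2l// -[X in _ <= X]mulrA.
    apply: (@le_trans _ _ (S' ^+ 2 * sqnorm y)); last by rewrite ler_wpM2l ?sqr_ge0.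
    by apply: sqnorm_scale_blocks => j; rewrite invr_ge0 ltW.
  by rewrite -!mulrA ler_pM2l// -hX.
have := ler_wpM2l t0 b1.
have := le_trans (sqnormY_le_sqnorm _) (ler_wpM2l S'0 b2).
rewrite /HMop /= -/x -/y {1 3}/sqnormX -/t -/S' => h2 h1.
apply: le_trans (lerD h1 h2) _; rewrite /K.
rewrite -subr_ge0; set u := sqnormX tau x in nX *; set v := sqnormY sigma y in nY *.
have -> : (t * (2 * t) + t * (4 * (P * c2) + 4 * c2) * S + S' * (2 * S' ^+ 2 * S)
    + S' * (2 * c1 * tau)) * (u + v) -
    (t * (2 * t * u + (4 * (P * c2) + 4 * c2) * S * v)
    + S' * (2 * S' ^+ 2 * S * v + 2 * c1 * tau * u)) =
  (t * (4 * (P * c2) + 4 * c2) * S + S' * (2 * S' ^+ 2 * S)) * u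
  + (t * (2 * t) + S' * (2 * c1 * tau)) * v by ring.
by rewrite !(mulr_ge0, addr_ge0, sqr_ge0, sqnorm_ge0).
Qed.

Definition scaleZZ (a : R) (q : ZZ) : @ZZ R n m dim :=
  (fun i => a *: q.1 i, fun i => a *: q.2 i).

Lemma normZZ_scale (a : R) (q : @ZZ R n m dim) : 0 <= a ->
  normZZ p sigma tau (scaleZZ a q) = a * normZZ p sigma tau q.
Proof.
move=> a0; rewrite -[a in RHS]ger0_norm// -sqrtr_sqr /normZZ -sqrtrM ?sqr_ge0//.
congr Num.sqrt; rewrite mulr_sumr; apply: eq_bigr => i _ /=.
have -> : sqnormX tau (a *: q.1 i) = a ^+ 2 * sqnormX tau (q.1 i).
  by rewrite /sqnormX sqnormZ mulrCA.
have -> : sqnormY sigma (a *: q.2 i) = a ^+ 2 * sqnormY sigma (q.2 i).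
  by rewrite [RHS]mulr_sumr; apply: eq_bigr => j _; rewrite submxcolZ sqnormZ mulrCA.
by rewrite -mulrDr mulrCA.
Qed.

Lemma HMop_scale (a : R) (q : ZZ) :
  HMop A p sigma tau (scaleZZ a q) = scaleZZ a (HMop A p sigma tau q).
Proof.
rewrite /HMop /scaleZZ /=; congr (_, _); apply/funext => i.
  have -> : keep_block i (a *: q.2 i) = a *: keep_block i (q.2 i).
    apply/mxcolP => j; rewrite submxcolZ !mxcolK.
    by case: eqP => // _; rewrite ?submxcolZ ?scaler0.
  by rewrite -!scalemxAr scalerBr scalerDr !scalerA (mulrC a) (mulrC a).
have -> : scale_blocks (fun j => (sigma j)^-1) (a *: q.2 i) =
    a *: scale_blocks (fun j => (sigma j)^-1) (q.2 i).
  apply/mxcolP => j; rewrite submxcolZ !mxcolK submxcolZ !scalerA.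
  by rewrite mulrC.
by rewrite -scalemxAr scalerBr scalerN.
Qed.

Lemma le_normHM (q : ZZ) :
  normZZ p sigma tau (HMop A p sigma tau q)
  <= normHM A p sigma tau * normZZ p sigma tau q.
Proof.
have [c c0 hc] := HMop_bounded.
apply: (@le_opnorm _ _ _ _ _ _ scaleZZ c) => //.
- by move=> u; exact: sqrtr_ge0.
- exact: normZZ_scale.
- by move=> a u a0; rewrite HMop_scale normZZ_scale.
Qed.

Lemma sqr_normZZ (q : @ZZ R n m dim) :
  normZZ p sigma tau q ^+ 2 =
  \sum_i p i * (sqnormX tau (q.1 i) + sqnormY sigma (q.2 i)).
Proof.
rewrite sqr_sqrtr//; apply: sumr_ge0 => i _.
apply: mulr_ge0; [exact: ltW | apply: addr_ge0].
  by rewrite mulr_ge0 ?sqnorm_ge0// invr_ge0 ltW.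
by apply: sumr_ge0 => j _; rewrite mulr_ge0 ?sqnorm_ge0// invr_ge0 ltW.
Qed.

Lemma sqr_normZZ_HMop_le (q : ZZ) :
  \sum_i p i * (sqnormX tau ((HMop A p sigma tau q).1 i)
                + sqnormY sigma ((HMop A p sigma tau q).2 i))
  <= normHM A p sigma tau ^+ 2 *
     \sum_i p i * (sqnormX tau (q.1 i) + sqnormY sigma (q.2 i)).
Proof.
rewrite -!sqr_normZZ -exprMn lerXn2r ?nnegrE ?sqrtr_ge0// ?le_normHM//.
exact: le_trans (sqrtr_ge0 _) (le_normHM q).
Qed.

End OperatorNormHM.

(** * Iterates along one realization *)

Section Paths.
Context {R : realType} {n m : nat} {dim : 'I_n -> nat}.
Notation X := 'cV[R]_m.
Notation Y := 'cV[R]_(\sum_i dim i).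
Variables (A : forall i, 'M[R]_(dim i, m)).
Variables (f : forall i, 'cV[R]_(dim i) -> \bar R) (g : X -> \bar R).
Arguments f : clear implicits.
Variables (p sigma : 'I_n -> R) (tau gamma eta : R).
Variables (Omega : Type) (ix : nat -> Omega -> 'I_n) (x0 : X) (y0 : Y).
Variables (x : nat -> Omega -> X) (y ybar yhat : nat -> Omega -> Y).
Variables (xs : nat -> Omega -> X) (ys : nat -> Omega -> Y).
Hypotheses (hfg : standing_assumptions A f g).
Hypotheses (hp0 : forall i, 0 < p i) (hp1 : \sum_i p i = 1).
Hypothesis hstep : step_sizes A p sigma tau gamma.
Hypothesis hrun : forall w, spdhg_run A f g p sigma tau x0 y0
  (ix ^~ w) (x ^~ w) (y ^~ w) (ybar ^~ w).
Hypothesis hyhat : forall w,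
  full_dual_update A f sigma (x ^~ w) (y ^~ w) (yhat ^~ w).
Hypothesis hstar : forall w, is_star A f g p sigma tau
  (x ^~ w) (y ^~ w) (xs ^~ w) (ys ^~ w).
Hypothesis heta : 0 < eta.
Hypothesis hms : metric_subregularity A f g sigma tau eta x yhat.

Definition agree k (w w' : Omega) := forall i, (1 <= i <= k)%N -> ix i w = ix i w'.

Let Dk k w := Delta A p sigma tau (x ^~ w) (y ^~ w) (xs ^~ w) (ys ^~ w) k.

Let tau0 : 0 < tau. Proof. by case: hstep. Qed.
Let sigma0 i : 0 < sigma i. Proof. by case: hstep. Qed.
Let gamma0 : 0 <= gamma < 1. Proof. by case: hstep. Qed.
Let pf i : proper (f i). Proof. by case: hfg => /(_ i)[]. Qed.
Let pg : proper g. Proof. by case: hfg => _ []. Qed.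
Let cg : convex_ereal g. Proof. by case: hfg => _ []. Qed.
Let pcf i : proper (conjugate (f i)).
Proof. by apply: conjugate_proper; case: hfg. Qed.
Let ccf i : convex_ereal (conjugate (f i)).
Proof. exact: conjugate_convex. Qed.

Lemma agreeW k l w w' : (l <= k)%N -> agree k w w' -> agree l w w'.
Proof. by move=> lk h i /andP[i1 il]; apply: h; rewrite i1 (leq_trans il). Qed.

Lemma run0 w : [/\ x 0 w = x0, y 0 w = y0, y 1 w = y0 & ybar 1 w = y0]%N.
Proof. by have [] := hrun w. Qed.

Lemma prox_x k w : is_prox tau g
  (x k w - tau *: ((stack A)^T *m ybar k.+1 w)) (x k.+1 w).
Proof. by have [_ _ _ _ /(_ k.+1 isT)[]] := hrun w. Qed.

Lemma ybarE k w : ybar k.+1 w =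
  y k.+1 w + scale_blocks (fun j => (p j)^-1) (y k.+1 w - y k w).
Proof.
(* For [k = 0] the formula comes from the initialization: [ybar 1 = y 1], and the increment vanishes
   because [y 0 = y 1]. *)
case: k => [|k]; last by have [_ _ _ _ /(_ k.+1 isT)[]] := hrun w.
have [_ -> -> ->] := run0 w; rewrite subrr.
apply/mxcolP => j; rewrite submxcolD mxcolK submxcol0 scaler0.
by rewrite addr0.
Qed.

(** The drawn block and the same block of [yhat] are proximal points with equal data, hence
    equal. *)
Lemma y_update k w :
  y k.+2 w = update_block (ix k.+1 w) (y k.+1 w) (yhat k.+2 w).
Proof.
have [_ _ _ _ /(_ k.+1 isT)[_ hi hj _]] := hrun w.
apply/mxcolP => j; rewrite mxcolK; case: (eqVneq j (ix k.+1 w)) => [->|/hj//].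
exact: prox_unique (hyhat _ _ _).
Qed.

(** Each primal step precedes the draw of the same index, so the first [k] draws already fix
    [x k.+1]; uniqueness of proximal points propagates this from the deterministic start. *)
Lemma agree_next k w w' : agree k w w' ->
  [/\ y k.+1 w = y k.+1 w', ybar k.+1 w = ybar k.+1 w' & x k.+1 w = x k.+1 w'].
Proof.
elim: k => [|k IH] h.
  have [x00 _ -> ->] := run0 w; have [x00' _ -> ->] := run0 w'; split=> //.
  have h1 := prox_x 0 w.
  have [_ _ _ b1] := run0 w; have [_ _ _ b1'] := run0 w'.
  by apply: (prox_unique pg cg tau0 h1); rewrite x00 b1 -x00' -b1'; exact: prox_x.
have [hy hb hx] := IH (agreeW (leqnSn _) h).
have hix : ix k.+1 w = ix k.+1 w' by apply: h; rewrite leqnn.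
have yk : y k.+2 w = y k.+2 w'.
  have [_ _ _ _ /(_ k.+1 isT)[_ hi hj _]] := hrun w.
  have [_ _ _ _ /(_ k.+1 isT)[_ hi' hj' _]] := hrun w'.
  apply/mxcolP => j; have [->|jw] := eqVneq j (ix k.+1 w).
    by apply: prox_unique hi _ => //; rewrite hix hy hx.
  by rewrite hj// hj' -?hix// hy.
have bk : ybar k.+2 w = ybar k.+2 w' by rewrite !ybarE yk hy.
split=> //; have h1 := prox_x k.+1 w.
by apply: (prox_unique pg cg tau0 h1); rewrite hx bk; exact: prox_x.
Qed.

Lemma agree_xy k j w w' : agree k w w' -> (j <= k.+1)%N ->
  x j w = x j w' /\ y j w = y j w'.
Proof.
case: j => [|j] h; last by rewrite ltnS => jk; have [] := agree_next (agreeW jk h).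
by move=> _; have [-> -> _ _] := run0 w; have [-> -> _ _] := run0 w'.
Qed.

Lemma agree_yhat k w w' : agree k w w' -> yhat k.+2 w = yhat k.+2 w'.
Proof.
move=> /agree_next[hy _ hx]; apply/mxcolP => j.
by apply: prox_unique (hyhat w _ j) _ => //; rewrite hy hx; exact: hyhat.
Qed.

Lemma DeltaE k w : Dk k w =
  lyap A p sigma tau (y k.+1 w - y k w) (x k w - xs k w, y k.+1 w - ys k.+1 w).
Proof. by []. Qed.

Lemma star_Zstar k w : Zstar A f g (xs k w, ys k.+1 w).
Proof. by have [/(_ k.+1 isT)[]] := hstar w. Qed.

Lemma Delta_le k w xt yt : Zstar A f g (xt, yt) ->
  Dk k w <=
  lyap A p sigma tau (y k.+1 w - y k w) (x k w - xt, y k.+1 w - yt).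
Proof. by move=> zt; have [/(_ k.+1 isT)[_ /(_ _ zt)]] := hstar w. Qed.

(** Both realizations minimize the same function over the solutions, and the minimizer of one is a
    competitor in the other. *)
Lemma agree_Delta k w w' : agree k w w' -> Dk k w = Dk k w'.
Proof.
move=> h; have [hx hy] := agree_xy h (leqnSn k).
have [_ hy1] := agree_xy h (leqnn k.+1).
apply/eqP; rewrite eq_le; apply/andP; split.
  apply: le_trans (Delta_le k w (star_Zstar k w')) _.
  by rewrite DeltaE hx hy hy1.
apply: le_trans (Delta_le k w' (star_Zstar k w)) _.
by rewrite DeltaE hx hy hy1.
Qed.

Lemma y_single_block k w : single_block (y k.+1 w - y k w).
Proof.
case: k => [|k]; last by rewrite y_update; exact: update_block_single.
(* The first increment is zero, so any index serves as the exceptional block. *)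
have [_ -> -> _] := run0 w; exists (ix 0%N w) => j _.
by rewrite subrr submxcol0.
Qed.

Lemma err_le_Delta k w :
  (1 - gamma) / 2 * sqnormX tau (x k w - xs k w)
  + 2^-1 * sqnormYP sigma p (y k.+1 w - ys k.+1 w) <= Dk k w.
Proof. exact: (lyap_ge hp0 hstep _ _ (y_single_block k w)). Qed.

Lemma err_ge0 k w :
  0 <= (1 - gamma) / 2 * sqnormX tau (x k w - xs k w)
  + 2^-1 * sqnormYP sigma p (y k.+1 w - ys k.+1 w).
Proof.
have := sqnormX_ge0 hstep (x k w - xs k w).
have := sqnormYP_ge0 hp0 hstep (y k.+1 w - ys k.+1 w).
by have /andP[] := gamma0; nra.
Qed.

Section OneDraw.
(** The realizations [wa a] branch off from [w] at draw [k.+1]; sums weighted by [p a] play the part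
    of the conditional expectation. *)
Variables (k : nat) (w : Omega) (wa : 'I_n -> Omega).
Hypotheses (hw : forall a, agree k w (wa a)) (ha : forall a, ix k.+1 (wa a) = a).

Lemma draw_xy a : [/\ x k.+1 (wa a) = x k.+1 w, y k.+1 (wa a) = y k.+1 w &
  y k.+2 (wa a) = update_block a (y k.+1 w) (yhat k.+2 w)].
Proof.
have [hx hy] := agree_xy (hw a) (leqnn k.+1).
by split=> //; rewrite y_update ha -hy (agree_yhat (hw a)).
Qed.

(** The solution attaining [Dk k w] is kept as a competitor in every branch, where it bounds
    [Dk k.+1]; the decrease for a fixed solution then applies. *)
Lemma Delta_decrease :
  \sum_a p a * Dk k.+1 (wa a) <=
  Dk k w - V A p sigma tau (x k.+1 w - x k w, y k.+1 w - y k w).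
Proof.
have [gs fs] := Zstar_subdiff pf pcf (star_Zstar k w).
rewrite DeltaE.
apply: le_trans
  (expected_decrease (yhat := yhat k.+2 w) hp0 hp1 hstep _ _); last 2 first.
- have [_ gx] := prox_subdiff pg cg tau0 (prox_x k w).
  by have := subdiff_monotone pg gx gs; rewrite ybarE.
- move=> j; have [_ fy] :=
    prox_subdiff (pcf j) (@ccf j) (sigma0 j) (hyhat w (k := k.+1) isT j).
  exact: (subdiff_monotone (pcf j) fy (fs j)).
apply: ler_sum => a _; rewrite ler_pM2l//.
apply: le_trans (Delta_le _ _ (star_Zstar k w)) _.
by have [-> -> ->] := draw_xy a.
Qed.

(** The optimality conditions of the next primal step in branch [a] and of the present full dual
    update supply the subgradients. Branch [a] changes block [a] alone, so the extrapolation yields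
    exactly the [1 + (p a)^-1] term of [Hop]. *)
Lemma residual_KKT a (q := (fun i => x k.+1 w - x k.+2 (wa i),
    fun i => y k.+1 w - yhat k.+2 w) : ZZ) :
  KKT A f g (x k.+2 (wa a), yhat k.+2 w)
    ((HMop A p sigma tau q).1 a, (HMop A p sigma tau q).2 a).
Proof.
have [hx hy hu] := draw_xy a.
have [_ gx] := prox_subdiff pg cg tau0 (prox_x k.+1 (wa a)).
pose v : Y := \mxcol_j ((sigma j)^-1 *: (submxcol (y k.+1 w) j
  + sigma j *: (A j *m x k.+1 w) - submxcol (yhat k.+2 w) j)).
have := @KKT_subdiff R n dim f pf pcf m A g (x k.+2 (wa a)) (yhat k.+2 w) _ v gx.
rewrite /HMop /=.
set Y1 := y k.+1 w; set h := yhat k.+2 w; set xa := x k.+2 (wa a).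
set X1 := x k.+1 w.
have -> : v - stack A *m xa =
  scale_blocks (fun j => (sigma j)^-1) (Y1 - h) - - (stack A *m (X1 - xa)).
  apply/mxcolP => j; rewrite !(submxcolB, submxcolN) !mxcolK !submxcol_stack.
  rewrite opprK mulmxBr submxcolB addrA; congr (_ - _).
  by rewrite addrAC scalerDr scalerA mulVf ?lt0r_neq0// scale1r.
have -> : tau^-1 *: (x k.+1 (wa a) - tau *: ((stack A)^T *m ybar k.+2 (wa a)) - xa)
    + (stack A)^T *m h =
  tau^-1 *: (X1 - xa) + (1 + (p a)^-1) *: ((stack A)^T *m keep_block a (Y1 - h))
  - (stack A)^T *m (Y1 - h).
  have -> : ybar k.+2 (wa a) = Y1 - (1 + (p a)^-1) *: keep_block a (Y1 - h).
    rewrite ybarE hu hy; apply/mxcolP => j.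
    rewrite !(submxcolB, submxcolD) submxcolZ !mxcolK submxcolB mxcolK.
    case: eqP => [->|_]; last by rewrite subrr !scaler0 subr0 addr0.
    rewrite submxcolB -/Y1 -/h.
    rewrite -[submxcol Y1 a - submxcol h a]opprB scalerN opprK scalerDl scale1r.
    by rewrite addrA [submxcol Y1 a + _]addrC subrK.
  rewrite hx mulmxBr -scalemxAr addrAC scalerBr scalerA mulVf ?lt0r_neq0// scale1r.
  rewrite [in RHS]mulmxBr.
  move: (tau^-1 *: _) (_ *m Y1) (_ *: (_ *m keep_block _ _)) => b c d.
  by rewrite !opprB !addrA [RHS]addrAC; congr (_ + _); rewrite addrAC.
apply=> j; rewrite mxcolK.
by have [] := prox_subdiff (pcf j) (@ccf j) (sigma0 j) (hyhat w (k := k.+1) isT j).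
Qed.

Lemma sqnormX_addr_le (u v : X) :
  sqnormX tau (u + v) <= 2 * sqnormX tau u + 2 * sqnormX tau v.
Proof.
rewrite /sqnormX [2 * _]mulrCA [X in _ <= _ + X]mulrCA -mulrDr.
by rewrite ler_wpM2l ?sqnormD_le// invr_ge0 ltW.
Qed.

(** The weight [(p j)^-1] compensates the probability that block [j] is updated. *)
Lemma average_dual_step (Y1 h : Y) :
  \sum_a p a * sqnormYP sigma p (update_block a Y1 h - Y1) = sqnormY sigma (h - Y1).
Proof.
pose F j (v : 'cV[R]_(dim j)) := (sigma j)^-1 * (p j)^-1 * sqnorm (v - submxcol Y1 j).
rewrite (eq_bigr (fun a => p a * (\sum_j F j (submxcol (update_block a Y1 h) j)))).
  rewrite (average_update hp1); apply: eq_bigr => j _.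
  rewrite /F subrr sqnorm0 mulr0 add0r subr0 submxcolB.
  by field; rewrite !lt0r_neq0.
by move=> a _; congr (_ * _); apply: eq_bigr => j _; rewrite submxcolB.
Qed.

(* Averaging over the draw makes the residuals of the points (x^(k+2), yhat^(k+2))
   the components of (H - M) q, so that subregularity bounds their distances to
   the solutions by ||H - M|| times the expected step. *)
Lemma Delta_gap (pmin : R) : 0 <= pmin -> (forall j, pmin <= p j) ->
  pmin * (\sum_a p a * Dk k.+1 (wa a)) <=
  (2 + 2 * eta ^+ 2 * normHM A p sigma tau ^+ 2) *
  \sum_a p a * (sqnormX tau (x k.+2 (wa a) - x k.+1 (wa a))
                + sqnormYP sigma p (y k.+2 (wa a) - y k.+1 (wa a))).
Proof.
move=> pm0 pmp.
set D := pmin * _; set h := yhat k.+2 w; set X1 := x k.+1 w; set Y1 := y k.+1 w.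
set N2 := sqnormY sigma (h - Y1).
have stepA xt yt : Zstar A f g (xt, yt) ->
    D <= sqnormX tau (X1 - xt) + sqnormY sigma (h - yt) + 2 * N2.
  move=> zt; apply: le_trans (expected_lyap_le hp0 hp1 hstep X1 Y1 h xt yt pm0 pmp).
  rewrite ler_wpM2l//; apply: ler_sum => a _; rewrite ler_pM2l//.
  have [hx hy hu] := draw_xy a.
  by apply: le_trans (Delta_le _ _ zt) _; rewrite hx hu hy.
pose q : ZZ := (fun i => X1 - x k.+2 (wa i), fun i => Y1 - h).
have stepB a : D - 2 * N2 <= 2 * sqnormX tau (X1 - x k.+2 (wa a)) +
    2 * eta ^+ 2 * (sqnormX tau ((HMop A p sigma tau q).1 a)
                    + sqnormY sigma ((HMop A p sigma tau q).2 a)).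
  set xa := x k.+2 (wa a).
  (* The neighborhood of this one solution contains the points [(x k.+2, yhat k.+2)] of every
     branch. *)
  have [N [_ hN]] := hms (star_Zstar k w).
  move=> /(_ k.+2 (wa a) isT); rewrite -(agree_yhat (hw a)) => /hN.
  rewrite -/xa -/h => hdist.
  (* A lower bound for the distance of [(xa, h)] to every solution, by [stepA] and the triangle
     inequality through [xa]. For a negative radicand [Num.sqrt] is 0 and the bound is trivial. *)
  pose s := Num.sqrt ((D - 2 * N2 - 2 * sqnormX tau (X1 - xa)) / 2).
  have s_le : (s%:E <= distS tau sigma (xa, h) (Zstar A f g))%E.
    apply: le_ereal_inf_tmp => _ [[xt yt] zt <-]; rewrite lee_fin.
    rewrite ler_wsqrtr//= ler_pdivrMr// mulrC.
    have := stepA _ _ zt; have := sqnormX_addr_le (X1 - xa) (xa - xt).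
    rewrite addrA subrK; have := sqnormY_ge0 hstep (h - yt).
    by lra.
  have r_le : (distS tau sigma 0%R (KKT A f g (xa, h)) <=
      (normS tau sigma
        (0 - ((HMop A p sigma tau q).1 a, (HMop A p sigma tau q).2 a)))%:E)%E.
    apply: ereal_inf_lbound.
    exists ((HMop A p sigma tau q).1 a, (HMop A p sigma tau q).2 a) => //.
    exact: residual_KKT.
  have := le_trans s_le (le_trans hdist (lee_wpmul2l _ r_le)).
  rewrite lee_fin ltW// -EFinM lee_fin => /(_ isT) hs.
  have : s ^+ 2 <= (eta * normS tau sigma
      (0 - ((HMop A p sigma tau q).1 a, (HMop A p sigma tau q).2 a))) ^+ 2.
    rewrite lerXn2r ?nnegrE ?sqrtr_ge0//.
    exact: le_trans (sqrtr_ge0 _) hs.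
  rewrite exprMn [normS _ _ _ ^+ 2]sqr_sqrtr /=; last first.
    by rewrite addr_ge0 ?(sqnormX_ge0 hstep) ?(sqnormY_ge0 hstep).
  have -> : sqnormX tau (0 - (HMop A p sigma tau q).1 a) =
      sqnormX tau ((HMop A p sigma tau q).1 a).
    by rewrite /sqnormX sub0r sqnormN.
  have -> : sqnormY sigma (0 - (HMop A p sigma tau q).2 a) =
      sqnormY sigma ((HMop A p sigma tau q).2 a).
    by apply: eq_bigr => j _; rewrite submxcolB submxcol0 sub0r sqnormN.
  have : (D - 2 * N2 - 2 * sqnormX tau (X1 - xa)) / 2 <= s ^+ 2.
    have [h0|h0] := leP 0 ((D - 2 * N2 - 2 * sqnormX tau (X1 - xa)) / 2).
      by rewrite sqr_sqrtr.
    by apply: le_trans (sqr_ge0 _); rewrite ltW.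
  by lra.
have stepC : D - 2 * N2 <= \sum_a p a * (2 * sqnormX tau (X1 - x k.+2 (wa a)) +
    2 * eta ^+ 2 * (sqnormX tau ((HMop A p sigma tau q).1 a)
                    + sqnormY sigma ((HMop A p sigma tau q).2 a))).
  have -> : D - 2 * N2 = \sum_a p a * (D - 2 * N2) by rewrite -mulr_suml hp1 mul1r.
  by apply: ler_sum => a _; rewrite ler_pM2l.
have hHM := sqr_normZZ_HMop_le A hp0 tau0 sigma0 q.
pose S := \sum_a p a * sqnormX tau (X1 - x k.+2 (wa a)).
have qE : \sum_i p i * (sqnormX tau (q.1 i) + sqnormY sigma (q.2 i)) = S + N2.
  rewrite (eq_bigr (fun i => p i * sqnormX tau (q.1 i) + p i * N2)).
    by rewrite big_split /= -mulr_suml hp1 mul1r.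
  move=> i _; rewrite mulrDr /=; congr (_ + _ * _).
  by rewrite /N2; apply: eq_bigr => j _; rewrite !submxcolB sqnormBC.
rewrite qE in hHM.
have -> : \sum_a p a * (sqnormX tau (x k.+2 (wa a) - x k.+1 (wa a))
    + sqnormYP sigma p (y k.+2 (wa a) - y k.+1 (wa a))) = S + N2.
  rewrite /N2 -(average_dual_step Y1 h) -big_split /=; apply: eq_bigr => a _.
  by have [-> -> ->] := draw_xy a; rewrite mulrDr /sqnormX sqnormBC.
have : D - 2 * N2 <= 2 * S + 2 * eta ^+ 2 *
    (\sum_i p i * (sqnormX tau ((HMop A p sigma tau q).1 i)
                + sqnormY sigma ((HMop A p sigma tau q).2 i))).
  apply: le_trans stepC _; rewrite /S !mulr_sumr -big_split /=.
  rewrite le_eqVlt; apply/orP; left; apply/eqP; apply: eq_bigr => a _; ring.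
have := ler_wpM2l (mulr_ge0 (ler0n R 2) (sqr_ge0 eta)) hHM.
by lra.
Qed.

End OneDraw.

End Paths.

(** * Conditional expectation given finitely many draws *)

(** A nonnegative integral is a supremum over the simple functions below the integrand, which is
    monotone for arbitrary functions. This covers the error term of the theorem, whose minimizers
    are not shown to be measurable. *)
Lemma ge0_le_integralT (R : realType) (d : measure_display)
    (T : measurableType d) (mu : {measure set T -> \bar R}) (f1 f2 : T -> \bar R) :
  (forall x, (0 <= f1 x)%E) -> (forall x, (f1 x <= f2 x)%E) ->
  (\int[mu]_x f1 x <= \int[mu]_x f2 x)%E.
Proof.
move=> f10 f12; have f20 x : (0 <= f2 x)%E := le_trans (f10 x) (f12 x).
rewrite !ge0_integralTE//; apply: le_ereal_sup => _ [h hf1 <-].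
by exists h => // x; exact: le_trans (hf1 x) (f12 x).
Qed.

Section FiniteRange.
Context {R : realType} {disp : measure_display} {Omega : measurableType disp}.
Variables (P : probability Omega R) (T : finType) (H : Omega -> T) (u : T -> R).
Hypothesis mH : forall t, measurable [set w | H w = t].

Let uE w : (u (H w))%:E = (\sum_t (u t)%:E * (\1_[set w | H w = t] w)%:E)%E.
Proof.
rewrite (bigD1 (H w))//= indicE mem_set// mule1 big1 ?adde0// => t tw.
rewrite indicE memNset ?mule0// => /= /esym/eqP; exact/negP.
Qed.

Lemma integrable_finite_range B : measurable B ->
  P.-integrable B (fun w => (u (H w))%:E).
Proof.
move=> mB; rewrite (_ : (fun w => _) =
  fun w => (\sum_t (u t)%:E * (\1_[set w | H w = t] w)%:E)%E); last exact/funext.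
apply: integrable_sum => // t _; apply: integrableZl => //.
exact: integrableS (integrable_indic P (mH t)).
Qed.

Lemma integral_finite_range B : measurable B ->
  (\int[P]_(w in B) (u (H w))%:E)%E =
  (\sum_t u t * fine (P (B `&` [set w | H w = t])))%:E.
Proof.
move=> mB; under eq_integral => w _ do rewrite uE.
have iI t : P.-integrable B (fun w => (\1_[set w | H w = t] w)%:E).
  exact: integrableS (integrable_indic P (mH t)).
rewrite integral_sum//; last by move=> t; exact: integrableZl.
rewrite -sumEFin; apply: eq_bigr => t _.
rewrite integralZl// integral_indic// EFinM setIC fineK//.
by apply: fin_num_measure; apply: measurableI.
Qed.

End FiniteRange.

Lemma factor_through (T U S : Type) (H : T -> U) (F : T -> S) (s0 : S) :
  (forall w w', H w = H w' -> F w = F w') -> exists u, forall w, F w = u (H w).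
Proof.
move=> HF; exists (fun t => if pselect (exists w, H w = t) is left e
  then F (projT1 (cid e)) else s0) => w.
by case: pselect => [e|[]]; [apply: HF; case: cid | exists w].
Qed.

Section Conditioning.
Context {R : realType} {disp : measure_display} {Omega : measurableType disp}.
Variable P : probability Omega R.
Context {n : nat}.
Variables (p : 'I_n -> R) (ix : nat -> Omega -> 'I_n).
Hypotheses (hp0 : forall i, 0 < p i) (hix : independent_draws P p ix).

Let gen k := [set B | exists j (a : 'I_n),
  (1 <= j < k)%N /\ B = [set w | ix j w = a]].

Let filtE k : filtration ix k = @measurable _ (g_sigma_algebraType (gen k)).
Proof. by []. Qed.

Lemma filtration_measurable k B : filtration ix k B -> measurable B.
Proof.
apply: smallest_sub; first exact: sigma_algebra_measurable.
by move=> _ [j [a [/andP[j1 _] ->]]]; have [] := hix j1 a.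
Qed.

(** The sets that do not separate [w] from [w'] form a sigma-algebra containing the generators. *)
Lemma filtration_saturated k B w w' : filtration ix k.+1 B ->
  agree ix k w w' -> B w -> B w'.
Proof.
move=> FB ag; suff : B w <-> B w' by move=> [].
suff : filtration ix k.+1 `<=` [set B | B w <-> B w'] by move=> /(_ _ FB).
apply: smallest_sub.
  split=> //= [C h|C h].
    by split=> -[_ Cw]; split=> //; move: Cw; apply: contra_not => /h.
  by split=> -[i _ Ci]; exists i => //; apply/h.
move=> _ [j [a [/andP[j1 jk] ->]]] /=.
by rewrite (ag j)// j1 -ltnS.
Qed.

(** Draws are numbered from 1, so histories of length [k] belong to [filtration ix k.+1]. *)
Definition history k w : k.-tuple 'I_n := [tuple ix i.+1 w | i < k].

Lemma historyP k w w' : history k w = history k w' <-> agree ix k w w'.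
Proof.
split=> [h [|i]// /andP[_ ik]|h].
  by have := congr1 (fun t => tnth t (Ordinal ik)) h; rewrite !tnth_mktuple.
by apply: eq_from_tnth => i; rewrite !tnth_mktuple h// ltn_ord.
Qed.

Lemma filtration_history k t : filtration ix k.+1 [set w | history k w = t].
Proof.
rewrite (_ : mkset _ = \bigcap_(i in [set: 'I_k]) [set w | ix i.+1 w = tnth t i]).
  rewrite filtE; apply: fin_bigcap_measurable => // i _.
  by apply: sub_sigma_algebra; exists i.+1, (tnth t i); rewrite /= ltnS ltn_ord.
apply/seteqP; split=> [w <- i _|w h] /=; first by rewrite tnth_mktuple.
by apply: eq_from_tnth => i; rewrite tnth_mktuple; exact: h.
Qed.

Lemma measurable_history k t : measurable [set w | history k w = t].
Proof. exact: filtration_measurable (filtration_history t). Qed.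

(** By independence, each further draw multiplies the probability by a positive [p a]. *)
Lemma history_pos k w : (0 < P [set w' | history k w' = history k w])%E.
Proof.
elim: k => [|k IH].
  rewrite (_ : mkset _ = setT) ?probability_setT ?lte01//.
  by apply/seteqP; split=> // w' _; rewrite /= [LHS]tuple0 [RHS]tuple0.
rewrite (_ : mkset _ = [set w' | history k w' = history k w]
    `&` [set w' | ix k.+1 w' = ix k.+1 w]).
  have [_ pE ->] := hix (ltn0Sn k) (ix k.+1 w); last exact: filtration_history.
  by rewrite mule_gt0// pE lte_fin.
apply/seteqP; split=> w' /=.
  move=> /historyP h; split; last by apply: h; rewrite leqnn.
  by apply/historyP; exact: agreeW (leqnSn _) h.
move=> [/historyP h hk]; apply/historyP => i /andP[i1].
by rewrite leq_eqVlt => /orP[/eqP ->//|ik]; apply: h; rewrite i1 -ltnS.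
Qed.

(** The required event has positive probability, hence it is nonempty. *)
Lemma next_draw k w a : exists w', agree ix k w w' /\ ix k.+1 w' = a.
Proof.
have [_ pE /(_ _ (filtration_history (history k w)))] := hix (ltn0Sn k) a.
rewrite pE => h; have : (0 < P ([set w' | history k w' = history k w]
    `&` [set w' | ix k.+1 w' = a]))%E.
  by rewrite h mule_gt0 ?lte_fin// history_pos.
set C := (X in P X); have [->|/set0P[w' [/= h1 h2]] _] := eqVneq C set0.
  by rewrite measure0 ltxx.
by exists w'; split=> //; apply/historyP.
Qed.

(* A realization with the same first [k] draws as [w] and next draw [a]; it
   replaces running the algorithm on an index sequence outside [Omega]. *)
Definition next k w a : Omega := projT1 (cid (next_draw k w a)).

Lemma agree_nextP k w a : agree ix k w (next k w a).
Proof. by rewrite /next; case: cid => ? []. Qed.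

Lemma ix_next k w a : ix k.+1 (next k w a) = a.
Proof. by rewrite /next; case: cid => ? []. Qed.

Definition adapted k (U : Omega -> R) := forall w w', agree ix k w w' -> U w = U w'.

Definition average k (U : Omega -> R) w := \sum_a p a * U (next k w a).

Lemma agree_sym k w w' : agree ix k w w' -> agree ix k w' w.
Proof. by move=> h i /h ->. Qed.

Lemma agreeS k w w' : agree ix k w w' -> ix k.+1 w = ix k.+1 w' -> agree ix k.+1 w w'.
Proof.
move=> h hk i /andP[i1]; rewrite leq_eqVlt => /orP[/eqP ->//|ik].
by apply: h; rewrite i1 -ltnS.
Qed.

Lemma adapted_factor k U : adapted k U -> exists u, forall w, U w = u (history k w).
Proof. by move=> aU; apply: factor_through 0 _ => w w' /historyP/aU. Qed.

Lemma average_factor k U : adapted k.+1 U -> exists v : k.-tuple 'I_n * 'I_n -> R,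
  (forall w, U w = v (history k w, ix k.+1 w)) /\
  (forall w, average k U w = \sum_a p a * v (history k w, a)).
Proof.
move=> aU; have [|v hv] := @factor_through _ _ _
    (fun w => (history k w, ix k.+1 w)) U 0.
  move=> w w' e; apply: aU; apply: agreeS (congr1 snd e).
  by apply/historyP; exact: (congr1 fst e).
exists v; split=> // w; apply: eq_bigr => a _; congr (_ * _).
rewrite hv ix_next; congr (v (_, _)).
by apply/historyP; apply: agree_sym; exact: agree_nextP.
Qed.

Lemma adapted_average k U : adapted k.+1 U -> adapted k (average k U).
Proof.
by move=> /average_factor[v [_ vE]] w w' /historyP h; rewrite !vE h.
Qed.

Lemma adapted_integrable k U B : adapted k U -> measurable B ->
  P.-integrable B (EFin \o U).
Proof.
move=> /adapted_factor[u uE] mB.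
rewrite (_ : EFin \o U = fun w => (u (history k w))%:E).
  by apply: integrable_finite_range => // t; exact: measurable_history.
by apply/funext => w /=; rewrite uE.
Qed.

(** Both integrals are finite sums over histories. The part of [B] with a given history is in the
    past, so independence of draw [k.+1] splits off the factor [p a]. *)
Lemma integral_average k U B : adapted k.+1 U -> filtration ix k.+1 B ->
  (\int[P]_(w in B) (average k U w)%:E = \int[P]_(w in B) (U w)%:E)%E.
Proof.
move=> /average_factor[v [vE wE]] FB; have mB := filtration_measurable FB.
have mI a : measurable [set w | ix k.+1 w = a] by have [] := hix (ltn0Sn k) a.
under eq_integral => w _ do rewrite wE.
under [RHS]eq_integral => w _ do rewrite vE.
rewrite (integral_finite_range (H := history k) P
  (fun t => \sum_a p a * v (t, a)) (@measurable_history k) mB).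
rewrite (integral_finite_range (H := fun w => (history k w, ix k.+1 w))
  P v _ mB); last first.
  move=> [t a]; rewrite (_ : mkset _ = [set w | history k w = t]
    `&` [set w | ix k.+1 w = a]).
    by apply: measurableI => //; exact: measurable_history.
  by apply/seteqP; split=> w /= [-> ->].
congr (_%:E); transitivity (\sum_t \sum_a v (t, a) *
    fine (P (B `&` [set w | (history k w, ix k.+1 w) = (t, a)]))); last first.
  by rewrite pair_bigA; apply: eq_bigr => -[].
apply: eq_bigr => t _; rewrite mulr_suml; apply: eq_bigr => a _.
rewrite (_ : [set w | _ = (t, a)] = [set w | history k w = t]
    `&` [set w | ix k.+1 w = a]); last by apply/seteqP; split=> w /= [-> ->].
rewrite setIA; have [_ pE ->] := hix (ltn0Sn k) a; last first.
  by rewrite filtE; apply: measurableI => //; exact: filtration_history.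
rewrite pE fineM//; first by rewrite /=; ring.
by apply: fin_num_measure; apply: measurableI => //; exact: measurable_history.
Qed.

Lemma adapted_preimage k U (B : set R) : adapted k U -> filtration ix k.+1 (U @^-1` B).
Proof.
move=> /adapted_factor[u uE].
rewrite (_ : _ @^-1` _ = \bigcup_(t in [set t | B (u t)]) [set w | history k w = t]).
  rewrite filtE; apply: fin_bigcup_measurable => // t _; exact: filtration_history.
apply/seteqP; split=> w /=; first by rewrite uE => Bw; exists (history k w).
by move=> [t Bt tE]; rewrite uE tE.
Qed.

Lemma is_cond_exp_average k U : adapted k.+1 U ->
  is_cond_exp P (filtration ix k.+1) U (average k U).
Proof.
move=> aU; split.
- exact: adapted_integrable aU _.
- exact: adapted_integrable (adapted_average aU) _.
- by move=> B _; apply: adapted_preimage; exact: adapted_average.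
- by move=> B FB; exact: integral_average.
Qed.

(* Every history has positive probability, so a version of the conditional
   expectation is determined everywhere, not only almost everywhere. *)
Lemma is_cond_exp_unique k U W : adapted k.+1 U ->
  is_cond_exp P (filtration ix k.+1) U W -> W =1 average k U.
Proof.
move=> aU [_ _ mW hW] w; pose B := [set w' | history k w' = history k w].
have FB : filtration ix k.+1 B by exact: filtration_history.
have mB := filtration_measurable FB.
have cst V : (forall w', B w' -> V w' = V w) ->
    (\int[P]_(w' in B) (V w')%:E = (V w)%:E * P B)%E.
  move=> hV; rewrite -integral_cst//; apply: eq_integral => w' /set_mem Bw'.
  by rewrite hV.
have := hW B FB; rewrite -(integral_average aU FB) !cst.
- have Pfin : P B \is a fin_num by apply: fin_num_measure.
  rewrite -(fineK Pfin) -!EFinM => -[] /mulIf; apply.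
  by rewrite gt_eqF// fine_gt0// history_pos ltey_eq Pfin.
- by move=> w' /historyP; exact: adapted_average.
- move=> w' /historyP /agree_sym ag.
  exact: (filtration_saturated (mW _ (measurable_set1 (W w))) ag).
Qed.

Lemma Rintegral_average k U : adapted k.+1 U ->
  \int[P]_w average k U w = \int[P]_w U w.
Proof.
move=> aU; congr fine; apply: integral_average => //.
by rewrite filtE; exact: measurableT.
Qed.

Lemma adapted_Rintegral_le k U V : adapted k U -> adapted k V ->
  (forall w, U w <= V w) -> \int[P]_w U w <= \int[P]_w V w.
Proof.
move=> aU aV UV; apply: le_Rintegral => //.
  exact: adapted_integrable aU measurableT.
exact: adapted_integrable aV measurableT.
Qed.

End Conditioning.

(** * Linear convergence *)

Theorem theorem4p5 (R : realType) (n m : nat) (dim : 'I_n -> nat)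
    (A : forall i, 'M[R]_(dim i, m))
    (f : forall i, 'cV[R]_(dim i) -> \bar R) (g : 'cV[R]_m -> \bar R)
    (p sigma : 'I_n -> R) (tau gamma eta : R)
    (disp : measure_display) (Omega : measurableType disp)
    (P : probability Omega R) (ix : nat -> Omega -> 'I_n)
    (x0 : 'cV[R]_m) (y0 : 'cV[R]_(\sum_i dim i))
    (x : nat -> Omega -> 'cV[R]_m)
    (y ybar yhat : nat -> Omega -> 'cV[R]_(\sum_i dim i))
    (xs : nat -> Omega -> 'cV[R]_m)
    (ys : nat -> Omega -> 'cV[R]_(\sum_i dim i))
    (hfg : standing_assumptions A f g)
    (hp0 : forall i, 0 < p i) (hp1 : \sum_i p i = 1)
    (hstep : step_sizes A p sigma tau gamma)
    (hix : independent_draws P p ix)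
    (hrun : forall w, spdhg_run A f g p sigma tau x0 y0
              (ix ^~ w) (x ^~ w) (y ^~ w) (ybar ^~ w))
    (hyhat : forall w,
       full_dual_update A f sigma (x ^~ w) (y ^~ w) (yhat ^~ w))
    (hstar : forall w, is_star A f g p sigma tau
               (x ^~ w) (y ^~ w) (xs ^~ w) (ys ^~ w))
    (heta : 0 < eta)
    (hms : metric_subregularity A f g sigma tau eta x yhat) :
  let Dk (k : nat) (w : Omega) : R :=
    Delta A p sigma tau (x ^~ w) (y ^~ w) (xs ^~ w) (ys ^~ w) k in
  let C1 : R := 1 - gamma in
  let zeta : R := 2 + 2 * eta ^+ 2 * normHM A p sigma tau ^+ 2 in
  let pmin : R := inf (range p) in
  let rho : R := C1 * pmin / (2 * zeta) in
  let Phi0 (w : Omega) : R :=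
    Dk 0%N w - C1 / (4 * zeta) * sqnormY sigma (y 0%N w - ys 0%N w) in
  let err (k : nat) (w : Omega) : R :=
    C1 / 2 * sqnormX tau (x k w - xs k w)
    + 2^-1 * sqnormYP sigma p (y k.+1 w - ys k.+1 w) in
  (forall k, (1 <= k)%N ->
     (exists W, is_cond_exp P (filtration ix k) (Dk k) W) /\
     (forall W, is_cond_exp P (filtration ix k) (Dk k) W ->
        {ae P, forall w, W w <= Dk k.-1 w
           - V A p sigma tau (x k w - x k.-1 w, y k w - y k.-1 w)})) /\
  (* Phi0 does not depend on the realization: it is built from x0, y0 and the
     minimizer of V_1, which are deterministic. *)
  (forall k, (1 <= k)%N -> forall w0 : Omega,
     ('E_P[err k] <= ((1 - rho) ^+ k * (2 * Phi0 w0))%:E)%E).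
Proof.
move=> Dk C1 zeta pmin rho Phi0 err.
have /andP[g0 g1] : 0 <= gamma < 1 by case: hstep.
have C1p : 0 < C1 by rewrite /C1; lra.
have C1le : C1 <= 1 by rewrite /C1; lra.
have zeta2 : 2 <= zeta.
  by rewrite /zeta lerDl mulr_ge0 ?sqr_ge0// mulr_ge0 ?sqr_ge0.
(* The probabilities sum to 1, so there is an index, and [pmin] is the infimum of a nonempty set. *)
have [j0 _|n0] := pickP 'I_n; last first.
  by exfalso; have := hp1; rewrite big_pred0// => /esym/eqP; rewrite oner_eq0.
have lbp : lbound (range p) 0 by move=> _ [j _ <-]; rewrite ltW.
have pm0 : 0 <= pmin by apply: lb_le_inf => //; exists (p j0), j0.
have pmp j : pmin <= p j by apply: ge_inf; [exists 0 | exists j].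
have ple1 j : p j <= 1.
  by rewrite -hp1 (bigD1 j)//= lerDl sumr_ge0// => i _; rewrite ltW.
have pm1 : pmin <= 1 := le_trans (pmp j0) (ple1 j0).
have aD k : adapted ix k (Dk k).
  by move=> w w' ag; exact: (agree_Delta hfg hstep hrun hstar ag).
pose G k w := sqnormX tau (x k.+1 w - x k w) + sqnormYP sigma p (y k.+1 w - y k w).
have aG k : adapted ix k (G k).
  move=> w w' ag; rewrite /G.
  have [-> ->] := agree_xy hfg hstep hrun ag (leqnn k.+1).
  by have [-> ->] := agree_xy hfg hstep hrun ag (leqnSn k).
have G0 k w : 0 <= G k w.
  by rewrite addr_ge0 ?(sqnormX_ge0 hstep)// (sqnormYP_ge0 hp0 hstep).
have V_geG k w : C1 / 2 * G k w <=
    V A p sigma tau (x k.+1 w - x k w, y k.+1 w - y k w).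
  apply: (V_ge hp0 hstep).
  exact: (y_single_block hfg hstep hrun hyhat).
have decr k w : average hp0 hix k (Dk k.+1) w <=
    Dk k w - V A p sigma tau (x k.+1 w - x k w, y k.+1 w - y k w).
  by apply: (Delta_decrease hfg hp0 hp1 hstep hrun hyhat hstar) => a;
     [exact: agree_nextP | exact: ix_next].
split=> [[//|k] _|].
  split; first by exists (average hp0 hix k (Dk k.+1)); exact: is_cond_exp_average.
  move=> W /(is_cond_exp_unique hp0 hix (aD k.+1)) WE; apply: aeW => w.
  by rewrite WE decr.
have iU k U : adapted ix k U -> P.-integrable setT (EFin \o U).
  by move=> aU; exact: (adapted_integrable hix aU measurableT).
pose e k := \int[P]_w Dk k w.
have aZ k (c : R) U : adapted ix k U -> adapted ix k (fun w => c * U w).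
  by move=> aU w w' /aU ->.
(* [Dk k] is compared with the next squared step [G], which is what the decrease
   at index [k.+1] pays for. *)
have gap k : pmin * e k.+1 <= zeta * \int[P]_w G k.+1 w.
  (* Both expectations are rewritten as those of averages over the next draw, where [Delta_gap]
     applies pointwise. *)
  rewrite /e -(Rintegral_average hp0 hix (aD k.+1)).
  rewrite -(Rintegral_average hp0 hix (aG k.+1)).
  have aaD := adapted_average hp0 hix (aD k.+1).
  have aaG := adapted_average hp0 hix (aG k.+1).
  rewrite -!RintegralZl//; [|exact: iU aaG|exact: iU aaD].
  apply: (adapted_Rintegral_le hix (aZ _ _ _ aaD) (aZ _ _ _ aaG)) => w.
  by apply: (Delta_gap hfg hp0 hp1 hstep hrun hyhat hstar heta hms _ _ pm0 pmp) => a;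
     [exact: agree_nextP | exact: ix_next].
have step k : e k.+1 <= e k - C1 / 2 * \int[P]_w G k w.
  rewrite /e -(Rintegral_average hp0 hix (aD k.+1)).
  rewrite -RintegralZl//; last exact: iU (aG k).
  rewrite -RintegralB//; [|exact: iU (aD k)|exact: iU (aZ _ (C1 / 2) _ (aG k))].
  apply: (adapted_Rintegral_le hix (adapted_average hp0 hix (aD k.+1))) => [w w' ag|w].
    by rewrite (aD k _ _ ag) (aG k _ _ ag).
  by apply: le_trans (decr k w) _; rewrite lerD2l lerN2 V_geG.
(* The decrease is at least [C1 / 2] times the expected [G k.+1], and [gap] bounds that expectation
   below by [pmin / zeta * e k.+1]; the product of the constants is [rho]. *)
have contraction k : e k.+2 <= (1 - rho) * e k.+1.
  apply: le_trans (step k.+1) _; rewrite [leRHS]mulrBl mul1r lerD2l lerN2.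
  have z0 : 0 < 2 * zeta by lra.
  rewrite /rho mulrAC ler_pdivrMr//.
  have := ler_wpM2l (ltW C1p) (gap k).
  by lra.
have rho_ge0 : 0 <= rho.
  by rewrite /rho divr_ge0 ?mulr_ge0//; [exact: ltW | lra].
have rho_le : rho <= 4^-1.
  rewrite /rho ler_pdivrMr; last by lra.
  by apply: le_trans (ler_pM (ltW C1p) pm0 C1le pm1) _; lra.
have D0E w w0 : Dk 0%N w = Dk 0%N w0.
  by apply: aD => i /andP[/leq_trans h /h].
move=> [//|k] _ w0.
(* Subregularity is not available at the first step, so [e 1] is only bounded by
   [Dk 0]; the missing factor [1 - rho] is absorbed by the factor 2 in front of
   [Phi0]. *)
have e1 : e 1%N <= Dk 0%N w0.
  apply: le_trans (step 0%N) _.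
  have -> : e 0%N = Dk 0%N w0.
    transitivity (\int[P]_(w in setT) Dk 0%N w0).
      by apply: eq_Rintegral => w _; exact: D0E.
    rewrite Rintegral_cst// -[RHS]mulr1; congr (_ * _).
    exact: (congr1 fine (probability_setT P)).
  rewrite gerBl mulr_ge0//; first by lra.
  by apply: Rintegral_ge0 => w _; exact: G0.
have Phi : Dk 0%N w0 <= (1 - rho) * (2 * Phi0 w0).
  have [_ y00 y10 _] := run0 hrun w0.
  have ys0 : ys 0%N w0 = ys 1%N w0 by have [_] := hstar w0.
  (* The dual part of [err_le_Delta] at 0, with [(p j)^-1 >= 1] to compare the norms; [y 0 = y 1]
     and [ys 0 = ys 1] reconcile the indices. *)
  have YP : sqnormY sigma (y 0%N w0 - ys 0%N w0) <= 2 * Dk 0%N w0.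
    have h1 := err_le_Delta xs ys hfg hp0 hstep hrun hyhat 0%N w0.
    have := sqnormX_ge0 hstep (x 0%N w0 - xs 0%N w0).
    have : sqnormY sigma (y 0%N w0 - ys 0%N w0) <=
        sqnormYP sigma p (y 1%N w0 - ys 1%N w0).
      rewrite y00 y10 ys0; apply: ler_sum => j _; rewrite ler_wpM2r ?sqnorm_ge0//.
      have [_ sigma0 _ _] := hstep.
      by rewrite ler_peMr ?invr_ge0 ?(ltW (sigma0 j))// invf_ge1.
    move: h1; rewrite -/C1 -/(Dk 0%N w0) => h1 h2 h3.
    by have := mulr_ge0 (ltW C1p) h3; lra.
  have Y0 := sqnormY_ge0 hstep (y 0%N w0 - ys 0%N w0).
  have D0 : 0 <= Dk 0%N w0 by lra.
  (* From [C1 <= 1] and [zeta >= 2], the term subtracted in [Phi0] is at most a quarter of [Dk 0].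
     With [rho <= 1/4], the right side is at least [3/4 * 2 * 3/4 = 9/8] times [Dk 0]. *)
  have c8 : C1 / (4 * zeta) <= 8^-1 by rewrite ler_pdivrMr; lra.
  have := ler_pM _ Y0 c8 YP; rewrite divr_ge0 => [/(_ isT) h| |]; [|lra|lra].
  have Phi_ge : 3 / 4 * Dk 0%N w0 <= Phi0 w0 by rewrite /Phi0; lra.
  have r34 : 3 / 4 <= 1 - rho by lra.
  have h32 : 3 / 2 * Dk 0%N w0 <= 2 * Phi0 w0 by lra.
  apply: (@le_trans _ _ (3 / 4 * (3 / 2 * Dk 0%N w0))); first by lra.
  by apply: ler_pM => //; lra.
have rho1 : 0 <= 1 - rho by lra.
have ek : e k.+1 <= (1 - rho) ^+ k * Dk 0%N w0.
  elim: k => [|k IH]; first by rewrite expr0 mul1r.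
  apply: le_trans (contraction k) _; rewrite exprS -[leRHS]mulrA.
  exact: ler_wpM2l.
have err_le w : err k.+1 w <= Dk k.+1 w.
  exact: (err_le_Delta xs ys hfg hp0 hstep hrun hyhat).
rewrite expectation.unlock.
apply: (@le_trans _ _ (\int[P]_w (Dk k.+1 w)%:E)%E).
  apply: ge0_le_integralT => w; rewrite lee_fin ?err_le//.
  exact: (err_ge0 x y xs ys hp0 hstep).
rewrite -[leLHS]fineK; last exact: (integrable_fin_num measurableT (iU _ _ (aD k.+1))).
rewrite lee_fin; apply: le_trans ek _; rewrite exprSr -mulrA ler_wpM2l//.
exact: exprn_ge0.
Qed.
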